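(* Let $T_i:\mathcal{E}\to\mathcal{E}$ be averaged with constant $\alpha_i\le\alpha<1$ for every $i\in I$. Assume $\operatorname{inv}\mathcal{P}\ne\emptyset$. Then for any initial distribution $\mu_0\in\mathscr{P}(\mathcal{E})$, the distributions $\mu_k=\mathcal{L}(X_k)=\mu_0\mathcal{P}^k$ of the iterates $X_k$ generated by the random function iteration $X_{k+1}=T_{\xi_k}X_k$, $X_0\sim\mu_0$, converge in the Prokhorov-Lévy metric to an invariant probability measure for $\mathcal{P}$.
   Context: $\mathcal{E}$ is a Euclidean space (finite-dimensional real inner product space) with its Borel $\sigma$-algebra $\mathcal{B}(\mathcal{E})$; $\mathscr{P}(\mathcal{E})$ is the set of Borel probability measures on $\mathcal{E}$. $(I,\mathcal{I})$ is a measurable space, $\xi$ is an $I$-valued random variable on a probability space $(\Omega,\mathcal{F},\mathbb{P})$, $(\xi_k)_{k\in\mathbb{N}}$ (with $0\in\mathbb{N}$) are i.i.d. with the same distribution as $\xi$, $X_0,\xi_0,\dots,\xi_k$ are independent for every $k$, and the map $(x,i)\mapsto T_ix$, $\mathcal{E}\times I\to\mathcal{E}$, is measurable. The transition kernel is $p(x,A)=\mathbb{P}(T_\xi x\in A)$; the associated Markov operator $\mathcal{P}$ acts on measures by $(\mu\mathcal{P})(A)=\int p(x,A)\,\mu(dx)$. $\operatorname{inv}\mathcal{P}=\{\pi\in\mathscr{P}(\mathcal{E}):\pi\mathcal{P}=\pi\}$. A map $F:\mathcal{E}\to\mathcal{E}$ is averaged with constant $\alpha\in(0,1)$ if $\|F(x)-F(y)\|^2\le\|x-y\|^2-\frac{1-\alpha}{\alpha}\|(F(x)-x)-(F(y)-y)\|^2$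 for all $x,y\in\mathcal{E}$. The Prokhorov-Lévy metric is $d_P(\mu,\nu)=\inf\{\epsilon>0:\mu(A)\le\nu(\mathbb{B}(A,\epsilon))+\epsilon,\ \nu(A)\le\mu(\mathbb{B}(A,\epsilon))+\epsilon\ \forall A\in\mathcal{B}(\mathcal{E})\}$, with $\mathbb{B}(A,\epsilon)=\bigcup_{x\in A}\{y:\|x-y\|<\epsilon\}$. *)

(* Defs.v *)
From HB Require Import structures.
From mathcomp Require Import all_boot all_order all_algebra.
From mathcomp Require Import all_classical all_reals all_analysis.
From mathcomp Require Import measurable_realfun.

Set Implicit Arguments.
Unset Strict Implicit.
Unset Printing Implicit Defensive.

Import Order.TTheory GRing.Theory Num.Theory.
Import numFieldNormedType.Exports.

Local Open Scope classical_set_scope.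
Local Open Scope ring_scope.

(* A Euclidean space: a finite-dimensional real vector space whose norm (hence
   topology) comes from an inner product, with its Borel sigma-algebra. *)
HB.mixin Record isEuclidean (R : realType) (d : measure_display) E
    & NormedModule R E & Vector R E & Measurable d E := {
  inner : {dot E for (@idfun R)} ;
  inner_norm : forall x : E, `|x| ^+ 2 = inner x x ;
  measurable_borel : d.-measurable = <<s (@open E) >>
}.

#[short(type="euclideanType")]
HB.structure Definition Euclidean (R : realType) (d : measure_display) :=
  { E of NormedModule R E & Vector R E & Measurable d E & isEuclidean R d E }.

Section averaged.
Context (R : realType) (E : normedModType R).

Definition averaged (a : R) (F : E -> E) : Prop :=
  0 < a < 1 /\
  forall x y : E, `|F x - F y| ^+ 2 <=
    `|x - y| ^+ 2 - (1 - a) / a * `|(F x - x) - (F y - y)| ^+ 2.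

End averaged.

Section prokhorov.
Context (R : realType) (d : measure_display) (E : euclideanType R d).

Definition enlargement (A : set E) (e : R) : set E :=
  \bigcup_(x in A) ball x e.

(* A genuine real infimum: the set is bounded below by 0 and, the measures being
   probabilities, contains 1. *)
Definition prokhorov_dist (mu nu : probability E R) : R :=
  inf [set e : R | 0 < e /\ forall A : set E, measurable A ->
    (mu A <= nu (enlargement A e) + e%:E)%E /\
    (nu A <= mu (enlargement A e) + e%:E)%E].

End prokhorov.

Section markov_operator.
Local Open Scope ereal_scope.
Context (R : realType) (d : measure_display) (E : measurableType d).
Variables (p : R.-pker E ~> E) (mu : probability E R).

Definition markov_op : set E -> \bar R := fun A => \int[mu]_x p x A.

Let markov_op0 : markov_op set0 = 0.
Proof.
by rewrite /markov_op (eq_integral (cst 0)) ?integral0// => y _; rewrite measure0.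
Qed.

Let markov_op_ge0 A : 0 <= markov_op A.
Proof. exact: integral_ge0. Qed.

Let markov_op_sigma_additive : semi_sigma_additive markov_op.
Proof.
move=> U mU tU mUU; rewrite [X in _ --> X](_ : _ =
  \int[mu]_y (\sum_(n <oo) p y (U n))); last first.
  apply: eq_integral => V _.
  by apply/esym/cvg_lim => //; exact/measure_semi_sigma_additive.
apply/cvg_closeP; split.
  by apply: is_cvg_nneseries => n _ _; exact: integral_ge0.
rewrite closeE// integral_nneseries// => n.
exact: measurable_kernel.
Qed.

HB.instance Definition _ := isMeasure.Build _ _ _ markov_op
  markov_op0 markov_op_ge0 markov_op_sigma_additive.

Let markov_opT : markov_op setT = 1.
Proof.
rewrite /markov_op (eq_integral (cst 1)); last by move=> x _; rewrite prob_kernel.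
by rewrite integral_cst// mul1e; exact: probability_setT.
Qed.

HB.instance Definition _ := Measure_isProbability.Build _ _ _
  markov_op markov_opT.

End markov_operator.

Section markov_iterates.
Context (R : realType) (d : measure_display) (E : measurableType d).
Variable p : R.-pker E ~> E.

Definition markov_iter (mu : probability E R) (k : nat) : probability E R :=
  iter k (fun nu : probability E R => markov_op p nu : probability E R) mu.

(* Measures are compared on measurable sets only: the library extends them to
   arbitrary sets, where their values carry no meaning. *)
Definition inv_measures : set (probability E R) :=
  [set pi | forall A, measurable A -> markov_op p pi A = pi A].

End markov_iterates.

Section transition_kernel.
Context (R : realType) (d dI dO : measure_display) (E : measurableType d)
  (I : measurableType dI) (Omega : measurableType dO) (P : probability Omega R).
Variable T : I -> E -> E.
Hypothesis mT : measurable_fun [set: E * I] (fun z : E * I => T z.2 z.1).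
Variable xi : {RV P >-> I}.

Definition random_map (x : E) (w : Omega) : E := T (xi w) x.

Let measurable_random_map2 :
  measurable_fun [set: E * Omega] (fun z : E * Omega => random_map z.1 z.2).
Proof.
rewrite (_ : (fun z : E * Omega => random_map z.1 z.2) =
  (fun z : E * I => T z.2 z.1) \o (fun z : E * Omega => (z.1, xi z.2)))//.
apply: measurableT_comp => //.
by apply: measurable_fun_pair => //; exact: measurableT_comp.
Qed.

Let measurable_random_map (x : E) : measurable_fun [set: Omega] (random_map x).
Proof. exact: (measurable_fun_pair2 x measurable_random_map2). Qed.

Definition random_map_RV (x : E) : {RV P >-> E} :=
  HB.pack_for {mfun Omega >-> E} (random_map x)
    (isMeasurableFun.Build _ _ _ _ (random_map x) (measurable_random_map x)).

Definition transition (x : E) : {measure set E -> \bar R} :=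
  distribution P (random_map_RV x).

Let measurable_transition (A : set E) :
  measurable A -> measurable_fun [set: E] (fun x => transition x A : \bar R).
Proof.
move=> mA.
have mB : measurable [set z : E * Omega | A (random_map z.1 z.2)].
  by rewrite -[X in measurable X]setTI; exact: measurable_random_map2.
have := measurable_fun_xsection P mB.
by congr (measurable_fun _ _); apply/funext => x /=; rewrite xsectionE.
Qed.

HB.instance Definition _ :=
  isKernel.Build _ _ E E R transition measurable_transition.

Let transitionT (x : E) : transition x [set: E] = 1%E.
Proof. exact: probability_setT. Qed.

HB.instance Definition _ :=
  Kernel_isProbability.Build _ _ E E R transition transitionT.

Definition transition_kernel : R.-pker E ~> E := transition.

End transition_kernel.

Section random_function_iteration.
Context (R : realType) (d dI dO : measure_display) (E : measurableType d)
  (I : measurableType dI) (Omega : measurableType dO) (P : probability Omega R).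

(* Mutual independence of every finite subfamily: the events ranging over all
   measurable B i, those with B i = setT give the smaller subfamilies. *)
Definition mutually_independent (xi_ : nat -> {RV P >-> I}) : Prop :=
  forall (n : nat) (B : nat -> set I), (forall i, measurable (B i)) ->
    P (\bigcap_(i < n) (xi_ i @^-1` B i)) =
    (\prod_(i < n) P (xi_ i @^-1` B i))%E.

Definition iid_copies (xi : {RV P >-> I}) (xi_ : nat -> {RV P >-> I}) : Prop :=
  mutually_independent xi_ /\
  forall k (B : set I), measurable B ->
    distribution P (xi_ k) B = distribution P xi B.

Definition independent_start (X0 : {RV P >-> E}) (xi_ : nat -> {RV P >-> I}) :
    Prop :=
  forall (k : nat) (A : set E) (B : nat -> set I),
    measurable A -> (forall i, measurable (B i)) ->
    P (X0 @^-1` A `&` \bigcap_(i < k.+1) (xi_ i @^-1` B i)) =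
    (P (X0 @^-1` A) * \prod_(i < k.+1) P (xi_ i @^-1` B i))%E.

Definition random_function_iteration (T : I -> E -> E)
    (xi_ : nat -> {RV P >-> I}) (mu0 : probability E R)
    (X : nat -> {RV P >-> E}) : Prop :=
  [/\ forall A : set E, measurable A -> distribution P (X 0%N) A = mu0 A,
      independent_start (X 0%N) xi_ &
      forall k w, X k.+1 w = T (xi_ k w) (X k w)].

End random_function_iteration.

(* Main.v *)
Require Import Defs.
From HB Require Import structures.
From mathcomp Require Import all_boot all_order all_algebra.
From mathcomp Require Import all_classical all_reals all_analysis.
From mathcomp Require Import measurable_realfun ring lra.

Set Implicit Arguments.
Unset Strict Implicit.
Unset Printing Implicit Defensive.

Import Order.TTheory GRing.Theory Num.Theory.
Import numFieldNormedType.Exports VectorInternalTheory.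

Local Open Scope classical_set_scope.
Local Open Scope ring_scope.

(** Let T be the random map, F_n a composition of n independent copies of it, and
    P the Markov operator, so that (P^n f)(x) is the expectation of f (F_n x).
    The maps being averaged with the common constant alpha, they satisfy
    |Tx - Ty|^2 + c |(Tx - Ty) - (x - y)|^2 <= |x - y|^2 with
    c = (1 - alpha) / alpha > 0, and so do their compositions with smaller c.

    The core is asymptotic regularity (asymptotic_regularity): the expectations of
    f at times n and n + 1 become close, uniformly over the functions f bounded by
    1 with a given Lipschitz constant. Nonexpansive maps preserve this class of
    functions, so it is enough to find n and k such that |F_n T y - F_n y| is
    small on average when y is distributed as the k-th iterate
    (small_displacement). Suppose there are none. Start two points x = y, and
    repeat rounds of the following kind: draw a step T, let only one of the two
    points make it, chosen with probability 1/2, and then move both points by the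
    same F_n. By the displayed inequality, common moves change the difference of
    the points little unless they shorten it. So a round replaces v = x - y by
    about v + u or v - u with u = F_n T y - F_n y, and by the parallelogram
    identity it increases the mean of |v|^2 by about that of |u|^2, which is
    bounded below by assumption (one_round_gain). The numbers n are chosen in
    periods during which the synchronous coupling loses little energy; such
    periods exist because the total loss is bounded. To obtain a contradiction
    the energy must be bounded, so |v|^2 is replaced by |v|^2 / (M^2 + |v|^2),
    which still gains for |v| small compared with M, and |x - y|^2 is capped when
    losses are measured. Tightness makes the resulting errors negligible, because
    each of the two points, seen alone, is a lazy version of the original chain.
    After enough rounds the saturated energy exceeds 1
    (displacement_contradiction).

    Tightness of the laws mu0 P^k comes from the invariant measure: driven by the
    same maps, a stationary chain stays within its initial distance of the given
    one (tight_of_invariant). Let L be the limit of the expectations along an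
    ultrafilter on the times. By tightness and Dini's theorem L is given by a
    probability measure nu (riesz_meanE), and asymptotic regularity makes nu
    invariant. On the class of Lipschitz test functions the convergence along the
    ultrafilter is uniform, so at some time N the law is close to nu; as P
    preserves nu and the class, it stays close at all later times
    (invariant_limit). Lipschitz functions interpolating between a set and its
    enlargement turn this into convergence for the Prokhorov distance
    (prokhorov_dist_le). Finally the law of X_k is mu0 P^k because X_k is
    independent of the noise from time k on (law_of_iterates). *)

(** * Expectations of bounded measurable functions *)

Section bounded_measurable.
Context (R : realType).

Definition bmeas d (T : measurableType d) (f : T -> R) : Prop :=
  measurable_fun [set: T] f /\ exists C, forall x, `|f x| <= C.

(** Real-valued, so that inequalities between expectations are a matter of
    linear arithmetic; on bounded measurable functions it is the integral. *)
Definition mean d (T : measurableType d) (mu : probability T R) (f : T -> R) : R :=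
  \int[mu]_x f x.

Section one_space.
Context d (T : measurableType d).
Implicit Types f g : T -> R.

Lemma bmeas_measurable f : bmeas f -> measurable_fun [set: T] f.
Proof. by case. Qed.

Lemma bmeas_cst c : bmeas (fun _ : T => c).
Proof. by split; [exact: measurable_cst|exists `|c|]. Qed.

Lemma bmeasD f g : bmeas f -> bmeas g -> bmeas (fun x => f x + g x).
Proof.
move=> [mf [C Cf]] [mg [D Dg]]; split; first exact: measurable_funD.
by exists (C + D) => x; rewrite (le_trans (ler_normD _ _))// lerD.
Qed.

Lemma bmeasM f g : bmeas f -> bmeas g -> bmeas (fun x => f x * g x).
Proof.
move=> [mf [C Cf]] [mg [D Dg]]; split; first exact: measurable_funM.
by exists (C * D) => x; rewrite normrM ler_pM.
Qed.

Lemma bmeasZ c f : bmeas f -> bmeas (fun x => c * f x).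
Proof. exact/bmeasM/bmeas_cst. Qed.

Lemma bmeasN f : bmeas f -> bmeas (fun x => - f x).
Proof.
by move=> [mf [C Cf]]; split; [exact: measurable_funN|
  exists C => x; rewrite normrN].
Qed.

Lemma bmeasB f g : bmeas f -> bmeas g -> bmeas (fun x => f x - g x).
Proof. by move=> bf bg; apply: bmeasD => //; exact: bmeasN. Qed.

Lemma bmeas_sum (I : Type) (s : seq I) (F : I -> T -> R) :
  (forall i, bmeas (F i)) -> bmeas (fun x => \sum_(i <- s) F i x).
Proof.
move=> bF; elim: s => [|i s IH].
  by under eq_fun do rewrite big_nil; exact: bmeas_cst.
by under eq_fun do rewrite big_cons; exact: bmeasD.
Qed.

Lemma bmeas_comp d' (T' : measurableType d') (h : T' -> T) f :
  measurable_fun [set: T'] h -> bmeas f -> bmeas (fun x => f (h x)).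
Proof.
move=> mh [mf [C Cf]]; split; last by exists C => x.
exact: measurableT_comp.
Qed.

Lemma bmeas_between f a b : measurable_fun [set: T] f ->
  (forall x, a <= f x <= b) -> bmeas f.
Proof.
move=> mf ab; split=> //; exists (`|a| + `|b|) => x.
have /andP[fa fb] := ab x.
rewrite ler_norml; apply/andP; split.
  apply: le_trans fa; rewrite lerNl (le_trans (ler_norm _))// normrN.
  by rewrite lerDl.
by rewrite (le_trans fb)// (le_trans (ler_norm _))// lerDr.
Qed.

Lemma bmeas_ltr f g : measurable_fun [set: T] f -> measurable_fun [set: T] g ->
  bmeas (fun x => (f x < g x)%R%:R).
Proof.
move=> mf mg; apply: (@bmeas_between _ 0 1); last first.
  by move=> x; case: (f x < g x); rewrite /= ?lexx ?ler01.
rewrite (_ : (fun _ => _) = fun x => if f x < g x then 1 else 0); last first.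
  by apply/funext => x; case: (f x < g x).
by apply: measurable_fun_ifT => //; exact: measurable_fun_ltr.
Qed.

Lemma bmeas_indic (A : set T) : measurable A -> bmeas (\1_A : T -> R).
Proof.
move=> mA; apply: (@bmeas_between _ 0 1); first exact: measurable_indic.
by move=> x; rewrite indicE; case: (_ \in _); rewrite /= ?lexx ?ler01.
Qed.

Lemma bmeas_if (b : T -> bool) f g : measurable_fun [set: T] b ->
  bmeas f -> bmeas g -> bmeas (fun x => if b x then f x else g x).
Proof.
move=> mb [mf [C Cf]] [mg [D Dg]]; split; first exact: measurable_fun_ifT.
exists (C + D) => x; have C0 := le_trans (normr_ge0 _) (Cf x).
have D0 := le_trans (normr_ge0 _) (Dg x).
by case: ifP => _ /=; [apply: (le_trans (Cf x)); rewrite lerDl|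
  apply: (le_trans (Dg x)); rewrite lerDr].
Qed.

Lemma bmeas_integrable (mu : probability T R) f : bmeas f ->
  mu.-integrable [set: T] (EFin \o f).
Proof.
move=> [mf [C Cf]]; apply: measurable_bounded_integrable => //.
  by rewrite [X in (X < _)%E]probability_setT ltry.
exists C; split; first by rewrite num_real.
by move=> M CM x _; apply: (le_trans (Cf x)); exact: ltW.
Qed.

Variable mu : probability T R.

Lemma mean_cst c : mean mu (fun=> c) = c.
Proof.
by rewrite /mean Rintegral_cst// [X in fine X]probability_setT/= mulr1.
Qed.

Lemma meanD f g : bmeas f -> bmeas g ->
  mean mu (fun x => f x + g x) = mean mu f + mean mu g.
Proof. by move=> bf bg; rewrite /mean RintegralD//; exact: bmeas_integrable. Qed.

Lemma meanZ c f : bmeas f -> mean mu (fun x => c * f x) = c * mean mu f.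
Proof. by move=> bf; rewrite /mean RintegralZl//; exact: bmeas_integrable. Qed.

Lemma meanN f : bmeas f -> mean mu (fun x => - f x) = - mean mu f.
Proof.
move=> bf; rewrite -mulN1r -meanZ//.
by congr mean; apply/funext => x; rewrite mulN1r.
Qed.

Lemma meanB f g : bmeas f -> bmeas g ->
  mean mu (fun x => f x - g x) = mean mu f - mean mu g.
Proof. by move=> bf bg; rewrite meanD ?meanN//; exact: bmeasN. Qed.

Lemma mean_ge0 f : (forall x, 0 <= f x) -> 0 <= mean mu f.
Proof. by move=> f0; exact: Rintegral_ge0. Qed.

Lemma le_mean f g : bmeas f -> bmeas g -> (forall x, f x <= g x) ->
  mean mu f <= mean mu g.
Proof. by move=> bf bg fg; apply: le_Rintegral => //; exact: bmeas_integrable. Qed.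

Lemma mean_le_cst f c : bmeas f -> (forall x, f x <= c) -> mean mu f <= c.
Proof. by move=> bf fc; rewrite -(mean_cst c); apply: le_mean => //; exact: bmeas_cst. Qed.

Lemma mean_ge_cst f c : bmeas f -> (forall x, c <= f x) -> c <= mean mu f.
Proof. by move=> bf fc; rewrite -(mean_cst c); apply: le_mean => //; exact: bmeas_cst. Qed.

Lemma mean_norm_le f c : bmeas f -> (forall x, `|f x| <= c) -> `|mean mu f| <= c.
Proof.
move=> bf fc; rewrite ler_norml; apply/andP; split.
  by apply: mean_ge_cst => // x; move: (fc x); rewrite ler_norml => /andP[].
by apply: mean_le_cst => // x; move: (fc x); rewrite ler_norml => /andP[].
Qed.

Lemma mean_indic (A : set T) : measurable A -> (mean mu \1_A)%:E = mu A.
Proof.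
move=> mA; rewrite /mean /Rintegral fineK; last first.
  by rewrite integral_indic// setIT fin_num_measure.
by rewrite integral_indic// setIT.
Qed.

Lemma EFin_mean f : bmeas f -> (mean mu f)%:E = (\int[mu]_x (f x)%:E)%E.
Proof.
by move=> bf; rewrite /mean /Rintegral fineK//;
  apply: integrable_fin_num => //; exact: bmeas_integrable.
Qed.

End one_space.

Lemma eq_mean d (T : measurableType d) (mu nu : probability T R) f :
  (forall A, measurable A -> mu A = nu A) -> mean mu f = mean nu f.
Proof.
move=> munu; rewrite /mean /Rintegral; congr fine.
by apply: eq_measure_integral => A mA _; exact: munu.
Qed.

Section two_spaces.
Context d1 d2 (T1 : measurableType d1) (T2 : measurableType d2).
Variables (mu1 : probability T1 R) (mu2 : probability T2 R).

Lemma bmeas_section (F : T1 * T2 -> R) x : bmeas F -> bmeas (fun y => F (x, y)).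
Proof. by move=> bF; apply: (bmeas_comp _ bF); exact: measurable_pair1. Qed.

Lemma bmeas_mean (F : T1 * T2 -> R) : bmeas F ->
  bmeas (fun x => mean mu2 (fun y => F (x, y))).
Proof.
move=> bF; have [mF [C CF]] := bF; split; last first.
  by exists C => x; apply: mean_norm_le => //; exact: bmeas_section.
(* The shift by C makes the integrand nonnegative. *)
have bFC : bmeas (fun z => F z + C) by apply: bmeasD => //; exact: bmeas_cst.
rewrite (_ : (fun x => _) = fun x => mean mu2 (fun y => F (x, y) + C) - C).
  apply: measurable_funB; last exact: measurable_cst.
  apply/measurable_EFinP.
  have FC0 z : (0 <= (F z + C)%:E)%E.
    by rewrite lee_fin -lerBlDr sub0r; have := CF z; rewrite ler_norml => /andP[].
  have mFC : measurable_fun setT (fun z => (F z + C)%:E).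
    by apply/measurable_EFinP; exact: bmeas_measurable bFC.
  have := @measurable_fun_fubini_tonelli_F _ _ _ _ R mu2 _ mFC FC0.
  apply: eq_measurable_fun => x _ /=.
  by rewrite EFin_mean//; exact: (bmeas_section x bFC).
apply/funext => x; rewrite meanD; [|exact: bmeas_section|exact: bmeas_cst].
by rewrite mean_cst addrK.
Qed.

Lemma mean_prod (F : T1 * T2 -> R) : bmeas F ->
  mean (mu1 \x mu2)%E F = mean mu1 (fun x => mean mu2 (fun y => F (x, y))).
Proof.
move=> bF; apply: EFin_inj; rewrite !EFin_mean//; last exact: bmeas_mean.
rewrite -(integral12_prod_meas1 (bmeas_integrable (mu1 \x mu2)%E bF)).
by apply: eq_integral => x _; rewrite EFin_mean//; exact: bmeas_section.
Qed.

End two_spaces.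

End bounded_measurable.

(** Dominated convergence with a constant bound. *)
Lemma mean_cvg (R : realType) d (T : measurableType d) (mu : probability T R)
    (f_ : nat -> T -> R) (f : T -> R) (C : R) :
  (forall n, measurable_fun [set: T] (f_ n)) -> bmeas f ->
  (forall n x, `|f_ n x| <= C) -> (forall x, f_ ^~ x @ \oo --> f x) ->
  (fun n => mean mu (f_ n)) @ \oo --> mean mu f.
Proof.
move=> mf_ bf Cf cf.
have bf_ n : bmeas (f_ n) by split=> //; exists C.
have [|||||_ _ h] := @dominated_convergence _ T R mu setT measurableT
  (fun n => EFin \o f_ n) (EFin \o f) (EFin \o (fun=> C)).
- by move=> n; apply/measurable_EFinP.
- by apply/measurable_EFinP; exact: bmeas_measurable.
- apply: aeW => x _; apply/fine_cvgP; split; first exact: nearW.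
  exact: cf.
- exact/bmeas_integrable/bmeas_cst.
- by apply: aeW => x n _ /=; rewrite lee_fin.
apply: fine_cvg.
by rewrite EFin_mean//.
Qed.

(** * Euclidean spaces *)

Section euclidean_space.
Context (R : realType) (d : measure_display) (E : euclideanType R d).
Implicit Types u v w x y : E.

Lemma inner_sym u v : inner u v = inner v u.
Proof. by rewrite hermC expr0 mul1r. Qed.

Lemma innerZl a u v : inner (a *: u) v = a * inner u v.
Proof. by rewrite linearZl_LR. Qed.

Lemma innerZr a u v : inner u (a *: v) = a * inner u v.
Proof. by rewrite linearZr_LR. Qed.

Lemma norm2D u v : `|u + v| ^+ 2 = `|u| ^+ 2 + `|v| ^+ 2 + 2 * inner u v.
Proof. by rewrite !inner_norm hnormD expr0 mul1r/=; ring. Qed.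

Lemma norm2B u v : `|u - v| ^+ 2 = `|u| ^+ 2 + `|v| ^+ 2 - 2 * inner u v.
Proof. by rewrite !inner_norm hnormB expr0 mul1r/=; ring. Qed.

Lemma cauchy_schwarz u v : inner u v ^+ 2 <= `|u| ^+ 2 * `|v| ^+ 2.
Proof.
have [->|u0] := eqVneq u 0.
  by rewrite linear0l !(expr0n, normr0)/= mul0r.
have u2 : 0 < `|u| ^+ 2 by rewrite exprn_gt0// normr_gt0.
set a := inner u v; set b := `|u| ^+ 2.
have : 0 <= `|b *: v - a *: u| ^+ 2 by rewrite exprn_ge0.
rewrite norm2B !normrZ !exprMn innerZl innerZr (inner_sym v u) -/a -/b.
rewrite !real_normK ?num_real//.
have -> : b ^+ 2 * `|v| ^+ 2 + a ^+ 2 * b - 2 * (b * (a * a)) =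
  b * (b * `|v| ^+ 2 - a ^+ 2) by ring.
by rewrite pmulr_rge0// subr_ge0.
Qed.

Lemma r2v_continuous : continuous (r2v : 'rV[R]_(dim E) -> E).
Proof.
apply: (@bounded_linear_continuous _ _ _ r2v); apply/linear_boundedP.
pose K := \sum_(i < dim E) `|r2v (delta_mx 0 i) : E|.
exists K; split; first exact: num_real.
move=> r Kr x; rewrite {1}(row_sum_delta x) linear_sum /=.
rewrite (le_trans (ler_norm_sum _ _ _))//.
apply: (@le_trans _ _ (K * `|x|)); last by rewrite ler_wpM2r// ltW.
rewrite mulr_suml; apply: ler_sum => i _.
rewrite linearZ/= normrZ mulrC ler_wpM2l//.
rewrite [leRHS]/Num.norm/= mx_normrE; apply/bigmax_geP; right => /=.
by exists (ord0, i).
Qed.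

(** The coordinate map does not shrink norms too much: the norm attains a
    minimum on the compact unit sphere of coordinates, and this minimum is
    positive because the coordinate map is injective. *)
Lemma r2v_norm_ge :
  exists2 m : R, 0 < m & forall c : 'rV[R]_(dim E), m * `|c| <= `|r2v c : E|.
Proof.
pose S := [set c : 'rV[R]_(dim E) | `|c| = 1].
have nZ (c : 'rV[R]_(dim E)) : c != 0 -> S (`|c|^-1 *: c).
  by move=> c0; rewrite /S/= normrZ normrV ?unitfE ?normr_eq0// normr_id mulVf
    ?normr_eq0.
have [[c0 Sc0]|S0] := pselect (S !=set0); last first.
  exists 1 => // c; have [->|/nZ Sc] := eqVneq c 0; first by rewrite normr0 mulr0.
  by exfalso; apply: S0; eexists; exact: Sc.
have cS : compact S.
  apply: bounded_closed_compact.
    by exists 1; split; [rewrite num_real|move=> M M1 x Sx /=; change (`|x| <= M); rewrite (Sx : `|x| = 1) ltW].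
  rewrite (_ : S = (@Num.norm _ _) @^-1` [set 1])//.
  by apply: closed_comp => [x _|]; [exact: norm_continuous|exact: closed_eq].
have [c /set_mem Sc cmin] : exists2 c, c \in S &
    forall t, t \in S -> `|r2v c : E| <= `|r2v t : E|.
  apply: (@EVT_min_rV R _ (fun c => `|r2v c : E|) S) => //; first by exists c0.
  apply: continuous_subspaceT => x.
  by apply: continuous_comp; [exact: r2v_continuous|exact: norm_continuous].
exists `|r2v c : E| => [|t].
  rewrite normr_gt0; apply/eqP => /(congr1 v2r); rewrite r2vK linear0 => c00.
  by move: Sc; rewrite /S/= c00 normr0 => /eqP; rewrite eq_sym oner_eq0.
have [->|t0] := eqVneq t 0; first by rewrite normr0 mulr0.
have := cmin _ (mem_set (nZ _ t0)); rewrite linearZ /= normrZ.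
rewrite normrV ?unitfE ?normr_eq0// normr_id.
by rewrite ler_pdivlMl ?normr_gt0// mulrC.
Qed.

Lemma compact_norm_le (r : R) : compact [set x : E | `|x| <= r].
Proof.
have [m m0 mP] := r2v_norm_ge.
pose B := [set c : 'rV[R]_(dim E) | `|r2v c : E| <= r].
have -> : [set x : E | `|x| <= r] = (r2v : 'rV[R]_(dim E) -> E) @` B.
  apply/seteqP; split => [x /= xr|_ [c /= Bc <-]//].
  by exists (v2r x); rewrite /B/= ?v2rK.
have cont : continuous (fun c : 'rV[R]_(dim E) => `|r2v c : E|).
  move=> x.
  by apply: continuous_comp; [exact: r2v_continuous|exact: norm_continuous].
apply: continuous_compact; first exact/continuous_subspaceT/r2v_continuous.
apply: bounded_closed_compact.
  exists (r / m); split; first exact: num_real.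
  move=> M rM c Bc; apply: le_trans (ltW rM).
  by rewrite ler_pdivlMr// mulrC (le_trans (mP c)).
rewrite (_ : B = (fun c => `|r2v c : E|) @^-1` [set x | x <= r])//.
by apply: closed_comp => [x _|]; [exact: cont|exact: closed_le].
Qed.

Lemma open_measurable_euclidean (A : set E) : open A -> measurable A.
Proof. by move=> oA; rewrite measurable_borel; exact: sub_sigma_algebra. Qed.

Lemma continuous_measurable_euclidean (f : E -> R) : continuous f ->
  measurable_fun [set: E] f.
Proof.
move=> cf; apply: (measurability _ (RGenOpens.measurableE R)) => _ [_ [a [b ->]] <-].
rewrite setTI; apply: open_measurable_euclidean.
by apply: open_comp => [x _|]; [exact: cf|exact: interval_open].
Qed.

Definition coordinate (i : 'I_(dim E)) (x : E) : R := v2r x ord0 i.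

Lemma coordinate_measurable i : measurable_fun [set: E] (coordinate i).
Proof.
apply: continuous_measurable_euclidean => x.
apply: (@continuous_comp _ _ _ (v2r : E -> 'rV[R]_(dim E)) (fun M => M ord0 i)); last exact: coord_continuous.
apply: (@bounded_linear_continuous _ _ _ v2r); apply/linear_boundedP.
have [m m0 mP] := r2v_norm_ge.
exists m^-1; split; first exact: num_real.
move=> r mr y; apply: (@le_trans _ _ (m^-1 * `|y|)); last by rewrite ler_wpM2r// ltW.
by rewrite ler_pdivlMl// -{2}(v2rK y).
Qed.

(** The squared distance is a polynomial in the coordinates of the two points,
    which is how it is seen to be measurable for the product sigma-algebra. *)
Lemma measurable_dist : measurable_fun [set: E * E] (fun z => `|z.1 - z.2|).
Proof.
pose e i : E := r2v (delta_mx 0 i).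
have normE (v : E) : `|v| = Num.sqrt (\sum_i \sum_j
    coordinate i v * coordinate j v * inner (e i) (e j)).
  rewrite -[LHS]ger0_norm// -sqrtr_sqr; congr Num.sqrt; rewrite inner_norm.
  have vE : v = \sum_i coordinate i v *: e i.
    rewrite -[LHS]v2rK (row_sum_delta (v2r v)) linear_sum /=.
    by apply: eq_bigr => i _; rewrite linearZ.
  rewrite [in LHS]vE linear_sumlz; apply: eq_bigr => i _.
  rewrite linear_sumr; apply: eq_bigr => j _.
  by rewrite -mulrA; apply: (etrans (innerZl _ _ _)); congr (_ * _); exact: innerZr.
under eq_fun do rewrite normE.
apply: (measurableT_comp (continuous_measurable_fun (@sqrt_continuous R))).
have mc i : measurable_fun [set: E * E] (fun z => coordinate i (z.1 - z.2)).
  rewrite (_ : (fun _ => _) = fun z => coordinate i z.1 - coordinate i z.2).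
    apply: measurable_funB; apply: measurableT_comp => //;
    exact: coordinate_measurable.
  by apply/funext => z; rewrite /coordinate linearB/= !mxE.
apply: measurable_sum => i; apply: measurable_sum => j.
by apply: measurable_funM => //; exact: measurable_funM.
Qed.

End euclidean_space.

(** * The saturated energy *)

Section saturation_scalar.
Context (R : realFieldType).
Implicit Types m A B p : R.

(** Trades a linear error for a quadratic one, which energies control; k is
    free. *)
Lemma le_add_sqr_div (t k : R) : 0 < k -> t <= k + t ^+ 2 / k.
Proof.
move=> k0; have t2 : 0 <= t ^+ 2 / k by rewrite divr_ge0 ?sqr_ge0// ltW.
have [tk|kt] := leP t k; first by lra.
suff : t <= t ^+ 2 / k by lra.
by rewrite ler_pdivlMr// expr2 ler_wpM2l// ltW// (lt_trans k0).
Qed.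

Let sat m r := r / (m + r).

(** Here A, B and p stand for the values of |v|^2, |u|^2 and <v, u>, and the
    expression is the second difference of the energy |v|^2 / (m + |v|^2) along
    v - u, v, v + u. Its sign is that of B (m + A + B) - 4 p^2, which the
    Cauchy-Schwarz inequality p^2 <= A B bounds from below. *)
Let sat_second_differenceE m A B p : 0 < m -> 0 <= A -> 0 <= B -> p ^+ 2 <= A * B ->
  [/\ 0 < (m + A + B) ^+ 2 - 4 * p ^+ 2,
      m ^+ 2 / 4 <= (m + A + B) ^+ 2 - 4 * p ^+ 2 &
  sat m (A + B + 2 * p) + sat m (A + B - 2 * p) - 2 * sat m A =
  2 * m * (B * (m + A + B) - 4 * p ^+ 2) /
    ((m + A) * ((m + A + B) ^+ 2 - 4 * p ^+ 2))].
Proof.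
move=> m0 A0 B0 pAB.
have D4 : m ^+ 2 / 4 <= (m + A + B) ^+ 2 - 4 * p ^+ 2.
  have DE : (m + A - B) ^+ 2 + 4 * m * B <= (m + A + B) ^+ 2 - 4 * p ^+ 2.
    have -> : (m + A + B) ^+ 2 = (m + A - B) ^+ 2 + 4 * m * B + 4 * (A * B) by ring.
    lra.
  apply: le_trans DE; have m2 : 0 < m ^+ 2 by rewrite exprn_gt0.
  have [mB|Bm] := leP (m / 2) B.
    have mmB : m * (m / 2) <= m * B by rewrite ler_pM2l.
    have sq : 0 <= (m + A - B) ^+ 2 by exact: sqr_ge0.
    have -> : m ^+ 2 / 4 = m * (m / 2) / 2 by field.
    have : 0 <= m * (m / 2) by rewrite !(mulr_ge0, divr_ge0) // ltW.
    lra.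
  have h : (m / 2) ^+ 2 <= (m + A - B) ^+ 2 by rewrite ler_sqr ?nnegrE; lra.
  have -> : m ^+ 2 / 4 = (m / 2) ^+ 2 by field.
  have : 0 <= m * B by rewrite mulr_ge0 // ltW.
  lra.
have D0 : 0 < (m + A + B) ^+ 2 - 4 * p ^+ 2.
  by apply: lt_le_trans D4; rewrite divr_gt0// exprn_gt0.
have p2 : (2 * p) ^+ 2 <= (A + B) ^+ 2.
  have : 0 <= (A - B) ^+ 2 by exact: sqr_ge0.
  have -> : (A - B) ^+ 2 = (A + B) ^+ 2 - 4 * (A * B) by ring.
  have -> : (2 * p) ^+ 2 = 4 * p ^+ 2 by ring.
  lra.
have : `|2 * p| <= A + B.
  by rewrite -(@ler_pXn2r _ 2) ?nnegrE ?addr_ge0// real_normK ?num_real.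
rewrite ler_norml => /andP[q0 q1].
split => //; rewrite /sat.
have n1 : m + (A + B + 2 * p) != 0 by rewrite gt_eqF//; lra.
have n2 : m + (A + B - 2 * p) != 0 by rewrite gt_eqF//; lra.
have n3 : m + A != 0 by rewrite gt_eqF//; lra.
have n4 := lt0r_neq0 D0.
by field; rewrite n4 n3 n2 n1.
Qed.

(** Far from the origin the energy is not convex any more, but its second
    difference is no worse than a multiple of B / m. *)
Lemma sat_second_difference_ge m A B p :
  0 < m -> 0 <= A -> 0 <= B -> p ^+ 2 <= A * B ->
  2 * sat m A - 24 * B / m <= sat m (A + B + 2 * p) + sat m (A + B - 2 * p).
Proof.
move=> m0 A0 B0 pAB.
have [D0 D4 E] := sat_second_differenceE m0 A0 B0 pAB.
set S := sat m (A + B + 2 * p) in E *; set S' := sat m (A + B - 2 * p) in E *.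
set D := (m + A + B) ^+ 2 - 4 * p ^+ 2 in D0 D4 E *.
suff : - (24 * B / m) <= S + S' - 2 * sat m A by lra.
rewrite E; have a0 : 0 < m + A by lra.
have N3 : - (3 * (m + A) * B) <= B * (m + A + B) - 4 * p ^+ 2.
  have : 0 <= m * B by rewrite mulr_ge0 // ltW.
  have : 0 <= B ^+ 2 by exact: sqr_ge0.
  have -> : B * (m + A + B) = m * B + A * B + B ^+ 2 by ring.
  have -> : 3 * (m + A) * B = 3 * (m * B) + 3 * (A * B) by ring.
  lra.
rewrite ler_pdivlMr; last by rewrite mulr_gt0.
apply: (@le_trans _ _ (2 * m * (- (3 * (m + A) * B)))); last first.
  by rewrite ler_pM2l// mulr_gt0.
have -> : - (24 * B / m) * ((m + A) * D) = - (24 / m * D) * ((m + A) * B).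
  by ring.
have -> : 2 * m * - (3 * (m + A) * B) = - (6 * m) * ((m + A) * B) by ring.
rewrite ler_wpM2r ?mulr_ge0 ?(ltW a0)// lerN2.
have -> : 6 * m = 24 / m * (m ^+ 2 / 4) by field; rewrite gt_eqF.
by rewrite ler_pM2l// divr_gt0.
Qed.

(** Near the origin the energy is close to |v|^2 / m, for which the parallelogram
    identity would give the gain 2 B / m. *)
Lemma sat_second_difference_gt m A B p :
  0 < m -> 0 <= A -> 0 <= B -> p ^+ 2 <= A * B -> A <= m / 9 -> B <= m ->
  2 * sat m A + B / (6 * m) <= sat m (A + B + 2 * p) + sat m (A + B - 2 * p).
Proof.
move=> m0 A0 B0 pAB Am Bm.
have [D0 D4 E] := sat_second_differenceE m0 A0 B0 pAB.
set S := sat m (A + B + 2 * p) in E *; set S' := sat m (A + B - 2 * p) in E *.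
set D := (m + A + B) ^+ 2 - 4 * p ^+ 2 in D0 D4 E *.
suff : B / (6 * m) <= S + S' - 2 * sat m A by lra.
rewrite E; have a0 : 0 < m + A by lra.
have N3 : 2 / 3 * m * B <= B * (m + A + B) - 4 * p ^+ 2.
  have : A * B <= m / 9 * B by rewrite ler_wpM2r.
  have : 0 <= B ^+ 2 by exact: sqr_ge0.
  have -> : B * (m + A + B) = m * B + A * B + B ^+ 2 by ring.
  have -> : m / 9 * B = m * B / 9 by ring.
  have -> : 2 / 3 * m * B = 2 / 3 * (m * B) by ring.
  lra.
rewrite ler_pdivlMr; last by rewrite mulr_gt0.
apply: (@le_trans _ _ (2 * m * (2 / 3 * m * B))); last first.
  by rewrite ler_pM2l// mulr_gt0.
have aD : (m + A) * D <= 8 * m ^+ 3.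
  have h1 : m + A <= 10 / 9 * m by lra.
  have h2 : D <= (19 / 9 * m) ^+ 2.
    apply: (@le_trans _ _ ((m + A + B) ^+ 2)).
      by rewrite /D gerBl mulr_ge0// sqr_ge0.
    by rewrite ler_sqr ?nnegrE; lra.
  apply: (@le_trans _ _ (10 / 9 * m * (19 / 9 * m) ^+ 2)).
    by rewrite ler_pM// ltW.
  have -> : 10 / 9 * m * (19 / 9 * m) ^+ 2 = 3610 / 729 * m ^+ 3 by field.
  have : 0 < m ^+ 3 by rewrite exprn_gt0.
  lra.
apply: (@le_trans _ _ (B / (6 * m) * (8 * m ^+ 3))).
  by rewrite ler_wpM2l// divr_ge0// mulr_ge0// ltW.
have -> : B / (6 * m) * (8 * m ^+ 3) = 4 / 3 * (m ^+ 2 * B).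
  by field; rewrite gt_eqF.
have -> : 2 * m * (2 / 3 * m * B) = 4 / 3 * (m ^+ 2 * B) by field.
exact: lexx.
Qed.

End saturation_scalar.

Section saturation.
Context (R : realType) (d : measure_display) (E : euclideanType R d).
Implicit Types u v w x y : E.

(** A bounded and Lipschitz substitute for |v|^2, whose expectation may be
    infinite; M is the scale up to which it behaves quadratically. *)
Definition saturate (M : R) (v : E) : R := `|v| ^+ 2 / (M ^+ 2 + `|v| ^+ 2).

Lemma saturate_ge0 M v : 0 <= saturate M v.
Proof. by rewrite divr_ge0 ?addr_ge0 ?sqr_ge0. Qed.

Lemma saturate_le1 M v : 0 < M -> saturate M v <= 1.
Proof.
move=> M0; rewrite ler_pdivrMr ?mul1r ?lerDr ?sqr_ge0//.
by rewrite ltr_wpDr ?sqr_ge0 ?exprn_gt0.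
Qed.

(** Applying 2 M a <= M^2 + a^2 to both norms bounds the difference quotient by
    1 / M. *)
Lemma saturate_lipschitz M v w : 0 < M ->
  saturate M v - `|w - v| / M <= saturate M w.
Proof.
move=> M0; rewrite /saturate.
set a := `|v|; set b := `|w|; set m := M ^+ 2.
have m0 : 0 < m by rewrite exprn_gt0.
have a0 : 0 <= a by exact: normr_ge0.
have b0 : 0 <= b by exact: normr_ge0.
have a2 : 0 <= a ^+ 2 by exact: sqr_ge0.
have b2 : 0 <= b ^+ 2 by exact: sqr_ge0.
have ab : a - b <= `|w - v| by rewrite distrC lerB_dist.
have [ba|ab'] := leP a b.
  rewrite (@le_trans _ _ (a ^+ 2 / (m + a ^+ 2)))//.
    by rewrite gerBl divr_ge0// ltW.
  have ab2 : a ^+ 2 <= b ^+ 2 by rewrite ler_sqr.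
  rewrite ler_pdivrMr; last by lra.
  rewrite mulrAC ler_pdivlMr; last by lra.
  have : m * a ^+ 2 <= m * b ^+ 2 by rewrite ler_pM2l.
  have -> : a ^+ 2 * (m + b ^+ 2) = m * a ^+ 2 + a ^+ 2 * b ^+ 2 by ring.
  have -> : b ^+ 2 * (m + a ^+ 2) = m * b ^+ 2 + a ^+ 2 * b ^+ 2 by ring.
  lra.
rewrite lerBlDr -lerBlDl.
apply: (@le_trans _ _ ((a - b) / M)); last by rewrite ler_pM2r ?invr_gt0.
have ma : 0 < m + a ^+ 2 by lra.
have mb : 0 < m + b ^+ 2 by lra.
have -> : a ^+ 2 / (m + a ^+ 2) - b ^+ 2 / (m + b ^+ 2) =
    (a - b) / M * (m * (M * a + M * b) / ((m + a ^+ 2) * (m + b ^+ 2))).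
  by rewrite /m; field; rewrite !gt_eqF.
rewrite ler_piMr ?divr_ge0 ?(ltW M0)//; first by lra.
rewrite ler_pdivrMr ?mulr_gt0// mul1r.
have Ma : M * a <= (m + a ^+ 2) / 2.
  have : 0 <= (M - a) ^+ 2 by exact: sqr_ge0.
  have -> : (M - a) ^+ 2 = m + a ^+ 2 - 2 * (M * a) by rewrite /m; ring.
  lra.
have Mb : M * b <= (m + b ^+ 2) / 2.
  have : 0 <= (M - b) ^+ 2 by exact: sqr_ge0.
  have -> : (M - b) ^+ 2 = m + b ^+ 2 - 2 * (M * b) by rewrite /m; ring.
  lra.
apply: (@le_trans _ _ (m * ((m + a ^+ 2) / 2 + (m + b ^+ 2) / 2))).
  by rewrite ler_pM2l// lerD.
have : 0 <= m * a ^+ 2 by rewrite mulr_ge0// ltW.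
have : 0 <= m * b ^+ 2 by rewrite mulr_ge0// ltW.
have : 0 <= a ^+ 2 * b ^+ 2 by rewrite mulr_ge0.
have -> : (m + a ^+ 2) * (m + b ^+ 2) =
  m * m + m * a ^+ 2 + m * b ^+ 2 + a ^+ 2 * b ^+ 2 by ring.
have -> : m * ((m + a ^+ 2) / 2 + (m + b ^+ 2) / 2) =
  m * m + m * a ^+ 2 / 2 + m * b ^+ 2 / 2 by field.
lra.
Qed.

Definition far (s : R) (x : E) : R := (s < `|x|)%R%:R.

Lemma far_ge0 s x : 0 <= far s x. Proof. exact: ler0n. Qed.

Lemma far_le s t x : s <= t -> far t x <= far s x.
Proof.
move=> st; rewrite /far ler_nat; case: ltP => // tx.
by rewrite (le_lt_trans st tx).
Qed.

Lemma far_split s x y : far (2 * s) x <= far s y + far s (x - y).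
Proof.
rewrite /far -natrD ler_nat.
have [ys|ys] := ltP s `|y|; first by case: (_ < _); case: (_ < _).
have [xys|xys] := ltP s `|x - y|; first by case: (_ < _).
have : `|x| <= 2 * s.
  by rewrite -(subrK y x) (le_trans (ler_normD _ _))//; lra.
by case: ltP.
Qed.

Lemma far_subr s x y : far (2 * s) (x - y) <= far s x + far s y.
Proof.
have := far_split s (x - y) (- y); rewrite opprK subrK /far normrN.
by rewrite [X in _ <= X -> _]addrC.
Qed.

(** What remains of the parallelogram identity after saturation: the gain is
    quadratic in u, and a cost of the same order is paid only for far v. *)
Lemma saturate_gain M u v : 0 < M -> `|u| <= M ->
  2 * saturate M v + `|u| ^+ 2 / (6 * M ^+ 2) <=
  saturate M (v + u) + saturate M (v - u) +
  25 * `|u| ^+ 2 / M ^+ 2 * far (M / 3) v.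
Proof.
move=> M0 uM; rewrite /far /saturate norm2D norm2B.
have m0 : 0 < M ^+ 2 by rewrite exprn_gt0.
have A0 : 0 <= `|v| ^+ 2 by exact: sqr_ge0.
have B0 : 0 <= `|u| ^+ 2 by exact: sqr_ge0.
have CS := cauchy_schwarz v u.
have [vM|vM] := ltP; rewrite ?mulr1 ?mulr0 ?addr0.
  have := sat_second_difference_ge m0 A0 B0 CS.
  have : 0 <= `|u| ^+ 2 / M ^+ 2 by rewrite divr_ge0// ltW.
  have -> : `|u| ^+ 2 / (6 * M ^+ 2) = `|u| ^+ 2 / M ^+ 2 / 6.
    by field; rewrite gt_eqF.
  have -> : 24 * `|u| ^+ 2 / M ^+ 2 = 24 * (`|u| ^+ 2 / M ^+ 2) by ring.
  have -> : 25 * `|u| ^+ 2 / M ^+ 2 = 25 * (`|u| ^+ 2 / M ^+ 2) by ring.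
  lra.
apply: sat_second_difference_gt => //.
  have -> : M ^+ 2 / 9 = (M / 3) ^+ 2 by field.
  by rewrite ler_sqr ?nnegrE// divr_ge0// ltW.
by rewrite ler_sqr ?nnegrE// ltW.
Qed.

(** This energy does not increase when the same nonexpansive map moves both
    points, so that its total loss along a common motion is bounded. *)
Definition capped_sqr (r : R) (v : E) : R := Num.min (`|v| ^+ 2) ((2 * r) ^+ 2).

(** Rigidity: an averaged map that changes the difference v of two points into w
    shortens it, |w - v|^2 being paid for by |v|^2 - |w|^2. The parameter kappa
    converts this into a bound on |w - v| itself. *)
Lemma rigid_cost (M r c kappa : R) v w : 0 < M -> 0 < c -> 0 < kappa ->
  `|v| <= 2 * r -> `|w| ^+ 2 + c * `|w - v| ^+ 2 <= `|v| ^+ 2 ->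
  `|w - v| / M <=
    kappa + (capped_sqr r v - capped_sqr r w) / (c * kappa * M ^+ 2).
Proof.
move=> M0 c0 k0 vr wv.
have D0 : 0 <= c * `|w - v| ^+ 2 by rewrite mulr_ge0 ?sqr_ge0// ltW.
have v2 : `|v| ^+ 2 <= (2 * r) ^+ 2.
  by rewrite ler_sqr ?nnegrE// (le_trans _ vr).
have w2 : `|w| ^+ 2 <= (2 * r) ^+ 2 by lra.
rewrite /capped_sqr !min_l//.
set t := `|w - v| / M.
have t2 : t ^+ 2 / kappa <= (`|v| ^+ 2 - `|w| ^+ 2) / (c * kappa * M ^+ 2).
  have -> : t ^+ 2 / kappa = (c * `|w - v| ^+ 2) / (c * kappa * M ^+ 2).
    by rewrite /t; field; rewrite !gt_eqF.
  by rewrite ler_pM2r ?invr_gt0 ?mulr_gt0 ?exprn_gt0//; lra.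
by apply: le_trans (le_add_sqr_div t k0) _; rewrite lerD2l.
Qed.

(** Dominates the errors made when x or y is far out: beyond the scale M / 6 the
    saturated energy need not gain, beyond the scale r the capped energy does
    not see losses. *)
Definition escape_cost (M r rho : R) x y : R :=
  13 * rho ^+ 2 / M ^+ 2 * (far (M / 6) x + far (M / 6) y) +
  2 * (far r x + far r y).

Section gain.
(* The points a and b are the images of x and y under a common move F, and a'
   and b' are their images under F after a preliminary common step. *)
Variables (M r rho c kappa : R) (x y a b a' b' : E).
Hypotheses (M0 : 0 < M) (c0 : 0 < c) (k0 : 0 < kappa) (rhoM : rho <= M).
Hypothesis ab : `|a - b| ^+ 2 + c * `|(a - b) - (x - y)| ^+ 2 <= `|x - y| ^+ 2.
Hypothesis ab' :
  `|a' - b'| ^+ 2 + c * `|(a' - b') - (x - y)| ^+ 2 <= `|x - y| ^+ 2.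

Let energy_loss := (2 * capped_sqr r (x - y) -
  capped_sqr r (a - b) - capped_sqr r (a' - b')) / (2 * (c * kappa * M ^+ 2)).

Let K0 : 0 < c * kappa * M ^+ 2.
Proof. by rewrite !mulr_gt0. Qed.

Let capped_le w w' : `|w| ^+ 2 + c * `|w - w'| ^+ 2 <= `|w'| ^+ 2 ->
  capped_sqr r w <= capped_sqr r w'.
Proof.
move=> h; rewrite /capped_sqr le_min !ge_min lexx orbT andbT.
by apply/orP; left; apply: le_trans h; rewrite lerDl mulr_ge0 ?sqr_ge0// ltW.
Qed.

Let energy_loss_ge0 : 0 <= energy_loss.
Proof.
apply: divr_ge0; last by rewrite mulr_ge0// ltW.
by have := capped_le ab; have := capped_le ab'; lra.
Qed.

Let coef_ge0 : 0 <= 13 * rho ^+ 2 / M ^+ 2.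
Proof. by apply: divr_ge0; rewrite ?sqr_ge0// mulr_ge0// sqr_ge0. Qed.

Let escape_ge0 : 0 <= escape_cost M r rho x y.
Proof. by apply: addr_ge0; apply: mulr_ge0 => //; apply: addr_ge0; exact: far_ge0. Qed.

Let rigid : `|x - y| <= 2 * r ->
  `|(a - b) - (x - y)| / M / 2 + `|(a' - b') - (x - y)| / M / 2 <=
  kappa + energy_loss.
Proof.
move=> vr; have := rigid_cost M0 c0 k0 vr ab; have := rigid_cost M0 c0 k0 vr ab'.
rewrite /energy_loss.
have -> : (2 * capped_sqr r (x - y) - capped_sqr r (a - b) -
  capped_sqr r (a' - b')) / (2 * (c * kappa * M ^+ 2)) =
  (capped_sqr r (x - y) - capped_sqr r (a - b)) / (c * kappa * M ^+ 2) / 2 +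
  (capped_sqr r (x - y) - capped_sqr r (a' - b')) / (c * kappa * M ^+ 2) / 2.
  by field; rewrite !gt_eqF.
lra.
Qed.

Let escape_ge2 : 2 * r < `|x - y| -> 2 <= escape_cost M r rho x y.
Proof.
move=> vr; have := far_subr r x y; rewrite {1}/far vr /escape_cost /= => h.
apply: ler_wpDl; last by lra.
by apply: mulr_ge0 => //; apply: addr_ge0; exact: far_ge0.
Qed.

(** By rigidity a common move alters the difference only at the expense of capped
    energy, and the saturated energy is Lipschitz. *)
Lemma common_move_loss :
  saturate M (x - y) <=
  (saturate M (a' - b') + saturate M (a - b)) / 2 + kappa + energy_loss +
  escape_cost M r rho x y.
Proof.
have [vr|vr] := leP `|x - y| (2 * r); last first.
  have := escape_ge2 vr; have := saturate_le1 (x - y) M0.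
  have := saturate_ge0 M (a' - b'); have := saturate_ge0 M (a - b).
  by have := energy_loss_ge0; have := k0; lra.
have := rigid vr; have := escape_ge0.
have := @saturate_lipschitz M (x - y) (a - b) M0.
by have := @saturate_lipschitz M (x - y) (a' - b') M0; lra.
Qed.

(** If only one of the two points makes the preliminary step, the resulting
    difference a - b' or a' - b is, up to rigidity errors, x - y - u or x - y + u
    with u = b' - b, and the average over the two cases gains |u|^2. *)
Lemma swapped_move_gain : `|b' - b| <= rho ->
  saturate M (x - y) + `|b' - b| ^+ 2 / (12 * M ^+ 2) <=
  (saturate M (a - b') + saturate M (a' - b)) / 2 + kappa + energy_loss +
  escape_cost M r rho x y.
Proof.
move=> urho; set u := b' - b in urho *.
have uM : `|u| <= M by exact: le_trans rhoM.
have m0 : 0 < M ^+ 2 by rewrite exprn_gt0.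
have u2 : `|u| ^+ 2 <= rho ^+ 2 by rewrite ler_sqr ?nnegrE// (le_trans _ urho).
have [vr|vr] := leP `|x - y| (2 * r); last first.
  have := escape_ge2 vr; have := saturate_le1 (x - y) M0.
  have := saturate_ge0 M (a - b'); have := saturate_ge0 M (a' - b).
  have : `|u| ^+ 2 / (12 * M ^+ 2) <= 1.
    rewrite ler_pdivrMr ?mulr_gt0// mul1r.
    have : `|u| ^+ 2 <= M ^+ 2 by rewrite ler_sqr ?nnegrE// ltW.
    by lra.
  by have := energy_loss_ge0; have := k0; lra.
have := rigid vr; have := saturate_gain (x - y) M0 uM.
have := @saturate_lipschitz M (x - y - u) (a - b') M0.
have -> : a - b' - (x - y - u) = a - b - (x - y).
  by rewrite /u opprB addrA subrKA.
have := @saturate_lipschitz M (x - y + u) (a' - b) M0.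
have -> : a' - b - (x - y + u) = a' - b' - (x - y).
  by rewrite /u opprD addrA addrAC opprB subrKA.
have -> : `|u| ^+ 2 / (12 * M ^+ 2) = `|u| ^+ 2 / M ^+ 2 / 12.
  by field; rewrite gt_eqF.
have -> : `|u| ^+ 2 / (6 * M ^+ 2) = `|u| ^+ 2 / M ^+ 2 / 6.
  by field; rewrite gt_eqF.
have : 25 / 2 * `|u| ^+ 2 / M ^+ 2 * far (M / 3) (x - y) <=
       escape_cost M r rho x y.
  apply: ler_wpDr; first by apply: mulr_ge0 => //; apply: addr_ge0; exact: far_ge0.
  apply: ler_pM; [|exact: far_ge0| |]; first by rewrite !mulr_ge0 ?invr_ge0 ?sqr_ge0.
    rewrite ler_pM2r ?invr_gt0//; have : 0 <= `|u| ^+ 2 by exact: sqr_ge0.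
    by lra.
  have -> : M / 3 = 2 * (M / 6) by field.
  exact: far_subr.
have -> : 25 / 2 * `|u| ^+ 2 / M ^+ 2 * far (M / 3) (x - y) =
  25 * `|u| ^+ 2 / M ^+ 2 * far (M / 3) (x - y) / 2 by field; rewrite gt_eqF.
by lra.
Qed.

End gain.

End saturation.

(** * Random maps and their operators *)

Section mean_functionals.
Context (R : realType) (d : measure_display) (Z : measurableType d).
Implicit Types (f g : Z -> R) (L : (Z -> R) -> R).

(** Finitely additive expectations: laws of pairs of points and limits of laws
    along an ultrafilter are both of this kind. *)
Record mean_functional L : Prop := MeanFunctional {
  mfD : forall f g, bmeas f -> bmeas g -> L (fun z => f z + g z) = L f + L g ;
  mfZ : forall c f, bmeas f -> L (fun z => c * f z) = c * L f ;
  mf_ge0 : forall f, bmeas f -> (forall z, 0 <= f z) -> 0 <= L f ;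
  mf1 : L (fun=> 1) = 1 }.

Variable L : (Z -> R) -> R.
Hypothesis mfL : mean_functional L.

Lemma mf_cst c : L (fun=> c) = c.
Proof.
by have := mfZ mfL c (bmeas_cst Z 1); rewrite (mf1 mfL) mulr1.
Qed.

Lemma mfN f : bmeas f -> L (fun z => - f z) = - L f.
Proof.
move=> bf; rewrite -mulN1r -(mfZ mfL)//.
by congr L; apply/funext => z; rewrite mulN1r.
Qed.

Lemma mfB f g : bmeas f -> bmeas g -> L (fun z => f z - g z) = L f - L g.
Proof. by move=> bf bg; rewrite (mfD mfL) ?mfN//; exact: bmeasN. Qed.

Lemma mf_le f g : bmeas f -> bmeas g -> (forall z, f z <= g z) -> L f <= L g.
Proof.
move=> bf bg fg; rewrite -subr_ge0 -mfB//; apply: (mf_ge0 mfL).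
  exact: bmeasB.
by move=> z; rewrite subr_ge0.
Qed.

Lemma mf_le_cst f c : bmeas f -> (forall z, f z <= c) -> L f <= c.
Proof. by move=> bf fc; rewrite -(mf_cst c); apply: mf_le => //; exact: bmeas_cst. Qed.

Lemma mf_ge_cst f c : bmeas f -> (forall z, c <= f z) -> c <= L f.
Proof. by move=> bf fc; rewrite -(mf_cst c); apply: mf_le => //; exact: bmeas_cst. Qed.

Lemma mf_sum (I : Type) (s : seq I) (F : I -> Z -> R) : (forall i, bmeas (F i)) ->
  L (fun z => \sum_(i <- s) F i z) = \sum_(i <- s) L (F i).
Proof.
move=> bF; elim: s => [|i s IH].
  by under eq_fun do rewrite big_nil; rewrite mf_cst big_nil.
under eq_fun do rewrite big_cons.
by rewrite (mfD mfL) ?IH ?big_cons//; exact: bmeas_sum.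
Qed.

End mean_functionals.

Lemma mean_mean_functional (R : realType) d (Z : measurableType d)
  (mu : probability Z R) : mean_functional (mean mu).
Proof.
split; [exact: meanD|exact: meanZ|by move=> f _; exact: mean_ge0|exact: mean_cst].
Qed.

Section random_maps.
Context (R : realType).

(** A random map carries its own probability space, so that independent
    compositions are random maps again. *)
Record randmap d (Z : measurableType d) := RandMap {
  rm_display : measure_display ;
  rm_space : measurableType rm_display ;
  rm_prob : probability rm_space R ;
  rm_map : rm_space -> Z -> Z ;
  rm_measurable : measurable_fun [set: Z * rm_space] (fun z => rm_map z.2 z.1) }.

Arguments rm_measurable {d Z} r.

Section operators.
Context d (Z : measurableType d).
Implicit Types (rho sigma : randmap Z) (f g : Z -> R).

Definition op rho f (x : Z) : R := mean (rm_prob rho) (fun j => f (rm_map j x)).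

Lemma bmeas_act rho f x : bmeas f -> bmeas (fun j : rm_space rho => f (rm_map j x)).
Proof.
move=> bf; apply: (bmeas_comp (h := fun j => rm_map j x)) bf.
exact: (measurable_fun_pair2 x (rm_measurable rho)).
Qed.

Lemma bmeas_op rho f : bmeas f -> bmeas (op rho f).
Proof.
move=> bf; apply: (bmeas_mean (rm_prob rho) (F := fun z => f (rm_map z.2 z.1))).
exact: bmeas_comp (rm_measurable rho) bf.
Qed.

Lemma mean_functional_op rho L : mean_functional L ->
  mean_functional (fun f : Z -> R => L (op rho f)).
Proof.
move=> mfL; split=> [f g bf bg|c f bf|f bf f0|].
- rewrite -(mfD mfL); [|exact: bmeas_op..].
  by congr L; apply/funext => x; rewrite /op meanD//; exact: bmeas_act.
- rewrite -(mfZ mfL); last exact: bmeas_op.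
  by congr L; apply/funext => x; rewrite /op meanZ//; exact: bmeas_act.
- by apply: (mf_ge0 mfL); [exact: bmeas_op|move=> z; exact: mean_ge0].
- by rewrite -[RHS](mf1 mfL); congr L; apply/funext => x; exact: mean_cst.
Qed.

Lemma mean_functional_op_at rho x : mean_functional (fun f => op rho f x).
Proof.
split=> [f g bf bg|c f bf|f bf f0|].
- by rewrite /op meanD//; exact: bmeas_act.
- by rewrite /op meanZ//; exact: bmeas_act.
- exact: mean_ge0.
- by rewrite /op mean_cst.
Qed.

Lemma le_op rho f g : bmeas f -> bmeas g -> (forall x, f x <= g x) ->
  forall x, op rho f x <= op rho g x.
Proof. by move=> bf bg fg x; exact: (mf_le (mean_functional_op_at rho x)). Qed.

Lemma measurable_rm_comp sigma rho : measurable_fun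
  [set: Z * (rm_space rho * rm_space sigma)]
  (fun z => rm_map z.2.2 (rm_map z.2.1 z.1)).
Proof.
apply: (measurableT_comp (rm_measurable sigma)
  (g := fun z : Z * (rm_space rho * rm_space sigma) =>
          (rm_map z.2.1 z.1, z.2.2))).
apply: measurable_fun_pair; last first.
  by apply: measurableT_comp => //; exact: measurable_snd.
apply: (measurableT_comp (rm_measurable rho)
  (g := fun z : Z * (rm_space rho * rm_space sigma) => (z.1, z.2.1))).
by apply: measurable_fun_pair => //; apply: measurableT_comp.
Qed.

(** Under the product measure the two maps are independent; rho acts first. *)
Definition rm_comp sigma rho : randmap Z :=
  @RandMap _ Z _ (rm_space rho * rm_space sigma)%type
    (rm_prob rho \x rm_prob sigma)%E
    (fun ij x => rm_map ij.2 (rm_map ij.1 x)) (@measurable_rm_comp sigma rho).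

Lemma op_comp sigma rho f : bmeas f ->
  op (rm_comp sigma rho) f = op rho (op sigma f).
Proof.
move=> bf; apply/funext => x; rewrite /op [LHS]mean_prod//.
exact: (@bmeas_act (rm_comp sigma rho)).
Qed.

(** The space of rho is a probability space at hand; any other would do. *)
Definition rm_id rho : randmap Z :=
  @RandMap _ Z _ (rm_space rho) (rm_prob rho) (fun _ x => x)
    (@measurable_fst _ _ Z (rm_space rho)).

Fixpoint rm_iter rho n : randmap Z :=
  if n is n'.+1 then rm_comp (rm_iter rho n') rho else rm_id rho.

Lemma op_iter rho n f : bmeas f -> op (rm_iter rho n) f = iter n (op rho) f.
Proof.
elim: n f => [|n IH] f bf.
  by apply/funext => x; exact: (mean_cst (rm_prob rho) (f x)).
by rewrite /= op_comp// IH.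
Qed.

Lemma bmeas_iter_op rho n f : bmeas f -> bmeas (iter n (op rho) f).
Proof. by move=> bf; elim: n => //= n IH; exact: bmeas_op. Qed.

Lemma le_iter_op rho n f g : bmeas f -> bmeas g -> (forall x, f x <= g x) ->
  forall x, iter n (op rho) f x <= iter n (op rho) g x.
Proof.
by move=> bf bg fg; elim: n => //= n IH; apply: le_op => //; exact: bmeas_iter_op.
Qed.

Lemma iter_op_ge0 rho n f : (forall x, 0 <= f x) ->
  forall x, 0 <= iter n (op rho) f x.
Proof. by move=> f0; elim: n => //= n IH x; exact: mean_ge0. Qed.

Lemma mean_functional_iter_op rho n L : mean_functional L ->
  mean_functional (fun f : Z -> R => L (iter n (op rho) f)).
Proof.
elim: n L => [|n IH] L mfL //.
exact: (IH _ (mean_functional_op rho mfL)).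
Qed.

Lemma measurable_rm_pair rho : measurable_fun [set: (Z * Z) * rm_space rho]
  (fun z => (rm_map z.2 z.1.1, rm_map z.2 z.1.2)).
Proof.
apply: measurable_fun_pair.
  apply: (measurableT_comp (rm_measurable rho)
    (g := fun z : (Z * Z) * rm_space rho => (z.1.1, z.2))).
  by apply: measurable_fun_pair => //; apply: measurableT_comp.
apply: (measurableT_comp (rm_measurable rho)
  (g := fun z : (Z * Z) * rm_space rho => (z.1.2, z.2))).
by apply: measurable_fun_pair => //; apply: measurableT_comp.
Qed.

End operators.

(** The synchronous coupling. *)
Definition rm_pair d (Z : measurableType d) (rho : randmap Z) :
    randmap (Z * Z)%type :=
  @RandMap _ (Z * Z)%type _ (rm_space rho) (rm_prob rho)
    (fun j z => (rm_map j z.1, rm_map j z.2)) (@measurable_rm_pair _ _ rho).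

Lemma op_pair_iter d (Z : measurableType d) (rho : randmap Z) n
  (F : Z * Z -> R) : bmeas F ->
  op (rm_pair (rm_iter rho n)) F = iter n (op (rm_pair rho)) F.
Proof.
elim: n F => [|n IH] F bF.
  by apply/funext => -[x y]; exact: (mean_cst (rm_prob rho) (F (x, y))).
by rewrite /= -IH// -op_comp.
Qed.

End random_maps.

Arguments rm_measurable {R d Z} r.

(** * Averaged random maps and the swapped step *)

Section averaged_random_maps.
Context (R : realType) (d : measure_display) (E : euclideanType R d).
Implicit Types (rho sigma : randmap R E) (x y : E) (f : E -> R) (F : E * E -> R).

(** Averagedness expressed by differences of points, the form that iterates well;
    c is (1 - alpha) / alpha. *)
Definition rm_averaged (c : R) rho : Prop := forall i x y,
  `|rm_map (r := rho) i x - rm_map i y| ^+ 2 +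
  c * `|(rm_map (r := rho) i x - rm_map i y) - (x - y)| ^+ 2 <= `|x - y| ^+ 2.

Lemma rm_averaged_le c c' rho : c' <= c -> rm_averaged c rho -> rm_averaged c' rho.
Proof.
move=> cc' h i x y; apply: le_trans (h i x y).
by rewrite lerD2l ler_wpM2r ?sqr_ge0.
Qed.

Lemma rm_averaged_nonexpansive c rho : 0 < c -> rm_averaged c rho ->
  forall i x y, `|rm_map (r := rho) i x - rm_map i y| <= `|x - y|.
Proof.
move=> c0 h i x y; rewrite -(@ler_pXn2r _ 2) ?nnegrE//.
by apply: le_trans (h i x y); rewrite lerDl mulr_ge0 ?sqr_ge0// ltW.
Qed.

(** The constants compose harmonically: c1 c2 / (c1 + c2) is the best constant k
    for which k |q + p|^2 <= c1 |p|^2 + c2 |q|^2. *)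
Lemma rm_averaged_comp c1 c2 rho sigma : 0 < c1 -> 0 < c2 ->
  rm_averaged c1 rho -> rm_averaged c2 sigma ->
  rm_averaged (c1 * c2 / (c1 + c2)) (rm_comp sigma rho).
Proof.
move=> c10 c20 h1 h2 [i j] x y /=.
set x1 := rm_map i x; set y1 := rm_map i y.
have := h1 i x y; have := h2 j x1 y1; rewrite -/x1 -/y1.
set p := x1 - y1 - (x - y); set q := rm_map j x1 - rm_map j y1 - (x1 - y1).
rewrite (_ : _ - _ - (x - y) = q + p); last by rewrite /p /q subrKA.
have c12 : 0 < c1 + c2 by rewrite addr_gt0.
have : c1 * c2 / (c1 + c2) * `|q + p| ^+ 2 <= c1 * `|p| ^+ 2 + c2 * `|q| ^+ 2.
  rewrite mulrAC ler_pdivrMr//.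
  apply: (@le_trans _ _ (c1 * c2 * (`|q| + `|p|) ^+ 2)).
    rewrite ler_pM2l ?mulr_gt0// ler_sqr ?nnegrE ?addr_ge0//.
    exact: ler_normD.
  rewrite -subr_ge0.
  rewrite (_ : _ - _ = (c1 * `|p| - c2 * `|q|) ^+ 2); first exact: sqr_ge0.
  by ring.
by move=> + + +; lra.
Qed.

Lemma rm_averaged_iter c rho n : 0 < c -> rm_averaged c rho ->
  rm_averaged (c / n.+1%:R) (rm_iter rho n).
Proof.
move=> c0 h; elim: n => [|n IH] /=.
  by move=> i x y; rewrite divr1 /= subrr normr0 expr0n/= mulr0 addr0.
rewrite (_ : c / n.+2%:R = c * (c / n.+1%:R) / (c + c / n.+1%:R)).
  by apply: rm_averaged_comp => //; rewrite divr_gt0.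
have n0 : 0 < n.+1%:R :> R by [].
have n1 : 0 < n.+2%:R :> R by [].
have -> : n.+2%:R = n.+1%:R + 1 :> R by rewrite -natr1.
field; rewrite -?natr1 !gt_eqF// ?addr_gt0 ?mulr_gt0//.
Qed.

Lemma measurable_norm_sub d' (X : measurableType d') (f g : X -> E) :
  measurable_fun [set: X] f -> measurable_fun [set: X] g ->
  measurable_fun [set: X] (fun w => `|f w - g w|).
Proof.
move=> mf mg.
apply: (measurableT_comp (@measurable_dist R d E) (g := fun w => (f w, g w))).
exact: measurable_fun_pair.
Qed.

Section swapping.
Variables (rho : randmap R E) (a : R).

(** A lazy step of a pair of points. If the step drawn for the second point is
    short, exactly one of the points makes it, each with probability 1/2;
    otherwise both make it or both stay. The two alternatives have the same
    marginals, but only the first one pulls the points apart. *)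
Definition swap_op (F : E * E -> R) (z : E * E) : R :=
  mean (rm_prob rho) (fun i =>
    if `|rm_map i z.2 - z.2| <= a
    then (F (z.1, rm_map i z.2) + F (rm_map i z.1, z.2)) / 2
    else (F (rm_map i z.1, rm_map i z.2) + F z) / 2).

Let swapped F (w : (E * E) * rm_space rho) : R :=
  if `|rm_map w.2 w.1.2 - w.1.2| <= a
  then (F (w.1.1, rm_map w.2 w.1.2) + F (rm_map w.2 w.1.1, w.1.2)) / 2
  else (F (rm_map w.2 w.1.1, rm_map w.2 w.1.2) + F w.1) / 2.

Let m1 : measurable_fun [set: (E * E) * rm_space rho] (fun w => w.1.1).
Proof. exact: measurableT_comp. Qed.

Let m2 : measurable_fun [set: (E * E) * rm_space rho] (fun w => w.1.2).
Proof. exact: measurableT_comp. Qed.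

Let mm1 : measurable_fun [set: (E * E) * rm_space rho] (fun w => rm_map w.2 w.1.1).
Proof.
apply: (measurableT_comp (rm_measurable rho)
  (g := fun w : (E * E) * rm_space rho => (w.1.1, w.2))).
exact: measurable_fun_pair.
Qed.

Let mm2 : measurable_fun [set: (E * E) * rm_space rho] (fun w => rm_map w.2 w.1.2).
Proof.
apply: (measurableT_comp (rm_measurable rho)
  (g := fun w : (E * E) * rm_space rho => (w.1.2, w.2))).
exact: measurable_fun_pair.
Qed.

Let bmeas_swapped F : bmeas F -> bmeas (swapped F).
Proof.
move=> bF; apply: bmeas_if.
- apply: measurable_fun_ler; last exact: measurable_cst.
  exact: measurable_norm_sub.
- apply: bmeasM; last exact: bmeas_cst.
  apply: bmeasD.
  + apply: (bmeas_comp (h := fun w : (E * E) * rm_space rho =>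
      (w.1.1, rm_map w.2 w.1.2)) _ bF).
    exact: measurable_fun_pair.
  + apply: (bmeas_comp (h := fun w : (E * E) * rm_space rho =>
      (rm_map w.2 w.1.1, w.1.2)) _ bF).
    exact: measurable_fun_pair.
- apply: bmeasM; last exact: bmeas_cst.
  apply: bmeasD; last exact: bmeas_comp bF.
  apply: (bmeas_comp (h := fun w : (E * E) * rm_space rho =>
    (rm_map w.2 w.1.1, rm_map w.2 w.1.2)) _ bF).
  exact: measurable_fun_pair.
Qed.

Lemma bmeas_swap_integrand F z : bmeas F -> bmeas (fun i : rm_space rho =>
    if `|rm_map i z.2 - z.2| <= a
    then (F (z.1, rm_map i z.2) + F (rm_map i z.1, z.2)) / 2
    else (F (rm_map i z.1, rm_map i z.2) + F z) / 2).
Proof. by move=> bF; exact: (bmeas_section z (bmeas_swapped bF)). Qed.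

Lemma bmeas_swap F : bmeas F -> bmeas (swap_op F).
Proof. by move=> bF; exact: (bmeas_mean _ (bmeas_swapped bF)). Qed.

Lemma mean_functional_swap L : mean_functional L ->
  mean_functional (fun F => L (swap_op F)).
Proof.
move=> mfL; split=> [f g bf bg|k f bf|f bf f0|].
- rewrite -(mfD mfL); [|exact: bmeas_swap..].
  congr L; apply/funext => z; rewrite /swap_op -meanD;
    [|exact: bmeas_swap_integrand..].
  by congr mean; apply/funext => i; case: ifP => _; field.
- rewrite -(mfZ mfL); last exact: bmeas_swap.
  congr L; apply/funext => z; rewrite /swap_op -meanZ; last exact: bmeas_swap_integrand.
  by congr mean; apply/funext => i; case: ifP => _; field.
- apply: (mf_ge0 mfL); first exact: bmeas_swap.
  by move=> z; apply: mean_ge0 => i; case: ifP => _; rewrite divr_ge0// addr_ge0.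
- rewrite -[RHS](mf1 mfL); congr L; apply/funext => z.
  rewrite -[RHS](mean_cst (rm_prob rho) 1); congr mean; apply/funext => i.
  by case: ifP => _; field.
Qed.

(** In both alternatives the first point steps with probability 1/2. *)
Lemma swap_fst f z : bmeas f ->
  swap_op (fun w => f w.1) z = (op rho f z.1 + f z.1) / 2.
Proof.
move=> bf; rewrite /swap_op (_ : (fun i => _) = fun i => (f (rm_map i z.1) + f z.1) / 2).
  under eq_fun do rewrite mulrC.
  rewrite meanZ; last by apply: bmeasD; [exact: bmeas_act|exact: bmeas_cst].
  by rewrite meanD ?mean_cst 1?mulrC//; [exact: bmeas_act|exact: bmeas_cst].
by apply/funext => i; case: ifP => //= _; rewrite addrC.
Qed.

Lemma swap_snd f z : bmeas f ->
  swap_op (fun w => f w.2) z = (op rho f z.2 + f z.2) / 2.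
Proof.
move=> bf; rewrite /swap_op (_ : (fun i => _) = fun i => (f (rm_map i z.2) + f z.2) / 2).
  under eq_fun do rewrite mulrC.
  rewrite meanZ; last by apply: bmeasD; [exact: bmeas_act|exact: bmeas_cst].
  by rewrite meanD ?mean_cst 1?mulrC//; [exact: bmeas_act|exact: bmeas_cst].
by apply/funext => i; case: ifP.
Qed.

End swapping.

Section displacement.
Variables (rho sigma : randmap R E) (a c : R).
Hypotheses (c0 : 0 < c) (avg_sigma : rm_averaged c sigma).

(** What a swapped step gains: the mean square distance of the images of T y and y
    under F, for independent T of law rho and F of law sigma. Long steps T are
    left out, which makes it finite. *)
Definition displacement (y : E) : R :=
  mean (rm_prob rho) (fun i => mean (rm_prob sigma) (fun j =>
    if `|rm_map i y - y| <= a
    then `|rm_map j (rm_map i y) - rm_map j y| ^+ 2 else 0)).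

Let integrand (w : (E * rm_space rho) * rm_space sigma) : R :=
  if `|rm_map w.1.2 w.1.1 - w.1.1| <= a
  then `|rm_map w.2 (rm_map w.1.2 w.1.1) - rm_map w.2 w.1.1| ^+ 2 else 0.

Let bmeas_integrand : bmeas integrand.
Proof.
have mT : measurable_fun [set: (E * rm_space rho) * rm_space sigma]
    (fun w => rm_map w.1.2 w.1.1).
  apply: (measurableT_comp (rm_measurable rho)
    (g := fun w : (E * rm_space rho) * rm_space sigma => (w.1.1, w.1.2))).
  by apply: measurable_fun_pair; apply: measurableT_comp.
have mx : measurable_fun [set: (E * rm_space rho) * rm_space sigma]
    (fun w => w.1.1) by exact: measurableT_comp.
split; last first.
  exists (a ^+ 2) => w; rewrite /integrand; case: ifPn => [h|_]; last first.
    by rewrite normr0 sqr_ge0.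
  rewrite normrX normr_id ler_sqr ?nnegrE// ?(le_trans _ h)//.
  exact: (rm_averaged_nonexpansive c0 avg_sigma).
apply: measurable_fun_ifT => //.
  apply: measurable_fun_ler; last exact: measurable_cst.
  exact: measurable_norm_sub.
apply: measurable_funX; apply: measurable_norm_sub.
  apply: (measurableT_comp (rm_measurable sigma)
    (g := fun w : (E * rm_space rho) * rm_space sigma => (rm_map w.1.2 w.1.1, w.2))).
  exact: measurable_fun_pair.
apply: (measurableT_comp (rm_measurable sigma)
  (g := fun w : (E * rm_space rho) * rm_space sigma => (w.1.1, w.2))).
exact: measurable_fun_pair.
Qed.

Lemma bmeas_displacement_inner y i : bmeas (fun j : rm_space sigma =>
    if `|rm_map (r := rho) i y - y| <= a
    then `|rm_map j (rm_map i y) - rm_map j y| ^+ 2 else 0).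
Proof. exact: (bmeas_section (y, i) bmeas_integrand). Qed.

Lemma bmeas_displacement_outer y : bmeas (fun i => mean (rm_prob sigma) (fun j =>
    if `|rm_map (r := rho) i y - y| <= a
    then `|rm_map j (rm_map i y) - rm_map j y| ^+ 2 else 0)).
Proof.
exact: (bmeas_section y (bmeas_mean (rm_prob sigma) bmeas_integrand)).
Qed.

Lemma bmeas_displacement : bmeas displacement.
Proof.
exact: (bmeas_mean (rm_prob rho) (bmeas_mean (rm_prob sigma) bmeas_integrand)).
Qed.

End displacement.

Lemma bmeas_saturate M : 0 < M -> bmeas (fun z : E * E => saturate M (z.1 - z.2)).
Proof.
move=> M0; apply: (@bmeas_between _ _ _ _ 0 1); last first.
  by move=> z; rewrite saturate_ge0 saturate_le1.
have cf : continuous (fun t : R => t ^+ 2 / (M ^+ 2 + t ^+ 2)).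
  move=> t; apply: cvgM; first exact: exprn_continuous.
  apply: cvgV; first by rewrite gt_eqF// ltr_wpDr ?sqr_ge0 ?exprn_gt0.
  by apply: cvgD; [exact: cvg_cst|exact: exprn_continuous].
apply: (measurableT_comp (continuous_measurable_fun cf)).
exact: measurable_dist.
Qed.

Lemma capped_sqr_ge0 r (v : E) : 0 <= capped_sqr r v.
Proof. by rewrite /capped_sqr le_min !sqr_ge0. Qed.

Lemma capped_sqr_le r (v : E) : capped_sqr r v <= (2 * r) ^+ 2.
Proof. by rewrite /capped_sqr ge_min lexx orbT. Qed.

Lemma bmeas_capped r : bmeas (fun z : E * E => capped_sqr r (z.1 - z.2)).
Proof.
apply: (@bmeas_between _ _ _ _ 0 ((2 * r) ^+ 2)); last first.
  by move=> z; rewrite capped_sqr_ge0 capped_sqr_le.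
apply: measurable_minr; last exact: measurable_cst.
by apply: measurable_funX; exact: measurable_dist.
Qed.

Lemma bmeas_far s : bmeas (far s : E -> R).
Proof.
apply: bmeas_ltr; first exact: measurable_cst.
apply: continuous_measurable_euclidean; exact: norm_continuous.
Qed.

End averaged_random_maps.

(** * The energy gained in one round *)

Section energy_gain.
Context (R : realType) (d : measure_display) (E : euclideanType R d).
Variables (rho : randmap R E) (c : R).
Hypotheses (c0 : 0 < c) (avg_rho : rm_averaged c rho).
Implicit Types (x y : E) (f : E -> R) (F : E * E -> R) (L : (E * E -> R) -> R).

Notation P := (op rho).
Notation Q := (op (rm_pair rho)).

(** Integrates an energy balance. The same balance is integrated three times: over
    the common moves, over the swapped step, and over the law of the pair. *)
Lemma mf_budget d' (Z : measurableType d') (l : (Z -> R) -> R)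
    (D G A B C : Z -> R) (k K : R) : mean_functional l ->
  bmeas D -> bmeas G -> bmeas A -> bmeas B -> bmeas C ->
  (forall z, D z * k <= G z - A z * K - B z * K + C z) ->
  l D * k <= l G - l A * K - l B * K + l C.
Proof.
move=> mfl bD bG bA bB bC h.
have bKA : bmeas (fun z => K * A z) by exact: bmeasZ.
have bKB : bmeas (fun z => K * B z) by exact: bmeasZ.
have b1 : bmeas (fun z => G z - K * A z) by exact: bmeasB.
have b2 : bmeas (fun z => G z - K * A z - K * B z) by exact: bmeasB.
have : l (fun z => k * D z) <= l (fun z => G z - K * A z - K * B z + C z).
  apply: (mf_le mfl); [exact: bmeasZ|exact: bmeasD|move=> z].
  by rewrite mulrC (mulrC K (A z)) (mulrC K (B z)).
rewrite (mfD mfl b2 bC) (mfB mfl b1 bKB) (mfB mfl bG bKA) !(mfZ mfl)//.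
by rewrite mulrC (mulrC K (l A)) (mulrC K (l B)).
Qed.

Section one_round.
Variables (M r a kappa : R) (n : nat).
Hypotheses (M0 : 0 < M) (k0 : 0 < kappa) (aM : a <= M).

Let H : E * E -> R := fun z => saturate M (z.1 - z.2).
Let q : E * E -> R := fun z => capped_sqr r (z.1 - z.2).
Let esc : E * E -> R := fun z => escape_cost M r a z.1 z.2.
(* The constant for n.+1 composed maps, which serves for n of them as well. *)
Let cn := c / n.+2%:R.

Let cn0 : 0 < cn.
Proof. by rewrite divr_gt0. Qed.

Let avg_n : rm_averaged cn (rm_iter rho n).
Proof.
apply: (@rm_averaged_le _ _ _ (c / n.+1%:R)); last exact: rm_averaged_iter.
by rewrite ler_pM2l// lef_pV2 ?posrE// ler_nat.
Qed.

Let avg_nS : rm_averaged cn (rm_iter rho n.+1).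
Proof. exact: rm_averaged_iter. Qed.

Let bH : bmeas H. Proof. exact: bmeas_saturate. Qed.
Let bq : bmeas q. Proof. exact: bmeas_capped. Qed.

Lemma bmeas_escape_cost : bmeas esc.
Proof.
have b1 s : bmeas (fun z : E * E => far s z.1).
  exact: (bmeas_comp (h := fst)) (bmeas_far E s).
have b2 s : bmeas (fun z : E * E => far s z.2).
  exact: (bmeas_comp (h := snd)) (bmeas_far E s).
by apply: bmeasD; apply: bmeasZ; exact: bmeasD.
Qed.

Let theta := displacement rho (rm_iter rho n) a.
Let k := (12 * M ^+ 2)^-1.
Let K := (2 * (cn * kappa * M ^+ 2))^-1.

Let round_pointwise z :
  theta z.2 * k <= swap_op rho a (iter n Q H) z - iter n Q q z * K -
    iter n.+1 Q q z * K + (kappa + 2 * q z * K + esc z - H z).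
Proof.
pose C := kappa + 2 * q z * K + esc z - H z; rewrite -/C iterS.
have bQq : bmeas (iter n Q q) by exact: bmeas_iter_op.
have := @mf_budget _ _ (mean (rm_prob rho))
  (fun i => mean (rm_prob (rm_iter rho n)) (fun j =>
    if `|rm_map i z.2 - z.2| <= a
    then `|rm_map j (rm_map i z.2) - rm_map j z.2| ^+ 2 else 0))
  (fun i => if `|rm_map i z.2 - z.2| <= a
    then (iter n Q H (z.1, rm_map i z.2) + iter n Q H (rm_map i z.1, z.2)) / 2
    else (iter n Q H (rm_map i z.1, rm_map i z.2) + iter n Q H z) / 2)
  (fun _ => iter n Q q z)
  (fun i => iter n Q q (rm_map i z.1, rm_map i z.2)) (fun _ => C) k K
  (mean_mean_functional _).
rewrite !mean_cst; apply.
- exact: (bmeas_displacement_outer rho a cn0 avg_n).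
- by apply: bmeas_swap_integrand; exact: bmeas_iter_op.
- exact: bmeas_cst.
- exact: (@bmeas_act _ _ _ (rm_pair rho)).
- exact: bmeas_cst.
move=> i; rewrite -!op_pair_iter//.
have bHn u : bmeas (fun j : rm_space (rm_iter rho n) =>
    H (rm_map j u.1, rm_map j u.2)).
  exact: (@bmeas_act _ _ _ (rm_pair (rm_iter rho n))).
have bqn u : bmeas (fun j : rm_space (rm_iter rho n) =>
    q (rm_map j u.1, rm_map j u.2)).
  exact: (@bmeas_act _ _ _ (rm_pair (rm_iter rho n))).
have half (f g : rm_space (rm_iter rho n) -> R) : bmeas f -> bmeas g ->
    mean (rm_prob (rm_iter rho n)) (fun j => (f j + g j) / 2) =
    (mean (rm_prob (rm_iter rho n)) f + mean (rm_prob (rm_iter rho n)) g) / 2.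
  move=> bf bg; rewrite -meanD// mulrC -meanZ; last exact: bmeasD.
  by congr mean; apply/funext => j; rewrite mulrC.
have [Tz|Tz] := ifPn.
  have := @mf_budget _ _ (mean (rm_prob (rm_iter rho n)))
    (fun j => `|rm_map j (rm_map i z.2) - rm_map j z.2| ^+ 2)
    (fun j => (H (rm_map j z.1, rm_map j (rm_map i z.2)) +
               H (rm_map j (rm_map i z.1), rm_map j z.2)) / 2)
    (fun j => q (rm_map j z.1, rm_map j z.2))
    (fun j => q (rm_map j (rm_map i z.1), rm_map j (rm_map i z.2)))
    (fun _ => C) k K (mean_mean_functional _).
  rewrite mean_cst half; [|exact: (bHn (_, _))..]; apply.
  - have := bmeas_displacement_inner a cn0 avg_n z.2 i; rewrite Tz; exact.
  - by apply: bmeasM; [apply: bmeasD; exact: (bHn (_, _))|exact: bmeas_cst].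
  - exact: (bqn (_, _)).
  - exact: (bqn (_, _)).
  - exact: bmeas_cst.
  move=> j; have := @swapped_move_gain _ _ _ M r a cn kappa z.1 z.2
    (rm_map j z.1) (rm_map j z.2) (rm_map j (rm_map i z.1))
    (rm_map j (rm_map i z.2)) M0 cn0 k0 aM.
  move=> /(_ (avg_n _ _ _) (avg_nS (i, j) _ _)) /(_ (le_trans _ Tz)).
  move=> /(_ (rm_averaged_nonexpansive cn0 avg_n _ _ _)).
  by rewrite /C /q /esc /H /k /K/=; lra.
have := @mf_budget _ _ (mean (rm_prob (rm_iter rho n)))
    (fun j => 0)
    (fun j => (H (rm_map j (rm_map i z.1), rm_map j (rm_map i z.2)) +
               H (rm_map j z.1, rm_map j z.2)) / 2)
    (fun j => q (rm_map j z.1, rm_map j z.2))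
    (fun j => q (rm_map j (rm_map i z.1), rm_map j (rm_map i z.2)))
    (fun _ => C) k K (mean_mean_functional _).
rewrite !mean_cst half; [|exact: (bHn (_, _))..]; apply.
- exact: bmeas_cst.
- by apply: bmeasM; [apply: bmeasD; exact: (bHn (_, _))|exact: bmeas_cst].
- exact: (bqn (_, _)).
- exact: (bqn (_, _)).
- exact: bmeas_cst.
move=> j; have := @common_move_loss _ _ _ M r a cn kappa z.1 z.2
  (rm_map j z.1) (rm_map j z.2) (rm_map j (rm_map i z.1))
  (rm_map j (rm_map i z.2)) M0 cn0 k0.
move=> /(_ (avg_n _ _ _) (avg_nS (i, j) _ _)).
by rewrite /C /q /esc /H /k /K/=; lra.
Qed.

(** A round, started from a pair with law L, is a swapped step followed by n
    common steps. It gains the displacement of the second point; the price is the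
    capped energy lost after n and after n.+1 common steps, since the step made
    or skipped in the swap counts as one more common step. *)
Lemma one_round_gain L : mean_functional L ->
  L H + L (fun w => theta w.2) * k <=
  L (swap_op rho a (iter n Q H)) + kappa +
  (2 * L q - L (iter n Q q) - L (iter n.+1 Q q)) * K + L esc.
Proof.
move=> mfL.
have b1 : bmeas (fun z => 2 * q z * K).
  by apply: bmeasM; [exact: bmeasZ|exact: bmeas_cst].
have b2 : bmeas (fun z => kappa + 2 * q z * K).
  by apply: bmeasD => //; exact: bmeas_cst.
have b3 : bmeas (fun z => kappa + 2 * q z * K + esc z).
  by apply: bmeasD => //; exact: bmeas_escape_cost.
have := mf_budget mfL _ _ _ _ _ round_pointwise.
rewrite (mfB mfL b3 bH) (mfD mfL b2 bmeas_escape_cost).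
rewrite (mfD mfL (bmeas_cst _ _) b1) (mf_cst mfL).
rewrite (_ : (fun z => 2 * q z * K) = (fun z => (2 * K) * q z)); last first.
  by apply/funext => z; ring.
rewrite (mfZ mfL)// => h.
suff : L (fun w => theta w.2) * k <= L (swap_op rho a (iter n Q H)) -
    L (iter n Q q) * K - L (iter n.+1 Q q) * K +
    (kappa + 2 * K * L q + L esc - L H) by lra.
apply: h.
- apply: (bmeas_comp (h := snd)) => //.
  exact: bmeas_displacement cn0 avg_n.
- by apply: bmeas_swap; exact: bmeas_iter_op.
- exact: bmeas_iter_op.
- exact: bmeas_iter_op.
- by apply: bmeasB.
Qed.

End one_round.
End energy_gain.

(** * Iterating the rounds *)

Section asymptotic_regularity.
Context (R : realType) (d : measure_display) (E : euclideanType R d).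
Variables (rho : randmap R E) (c : R) (mu0 : probability E R).
Hypotheses (c0 : 0 < c) (avg_rho : rm_averaged c rho).
Implicit Types (x y : E) (f : E -> R) (F : E * E -> R) (L : (E * E -> R) -> R).

Notation P := (op rho).
Notation Q := (op (rm_pair rho)).
Notation expect k f := (mean mu0 (iter k P f)).

(** Both marginals of L lie in the closed convex hull of the laws of the iterates,
    described by duality. Bounds on expectations valid at all times, such as
    tightness, therefore hold under L. *)
Definition in_hull L : Prop := forall f t, bmeas f ->
  (forall k, expect k f <= t) ->
  L (fun w => f w.1) <= t /\ L (fun w => f w.2) <= t.

Lemma in_hull_op L : in_hull L -> in_hull (fun F => L (Q F)).
Proof.
move=> hL f t bf ft; apply: (hL (P f) t); first exact: bmeas_op.
by move=> k; rewrite -iterSr; exact: ft.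
Qed.

Lemma in_hull_iter_op n L : in_hull L -> in_hull (fun F => L (iter n Q F)).
Proof. by elim: n L => [|n IH] L hL //; exact: (IH _ (in_hull_op hL)). Qed.

Lemma in_hull_swap a L : mean_functional L -> in_hull L ->
  in_hull (fun F => L (swap_op rho a F)).
Proof.
move=> mfL hL f t bf ft.
have bPf := bmeas_op rho bf.
have b1 (g : E -> R) : bmeas g -> bmeas (fun w : E * E => g w.1).
  exact: bmeas_comp.
have b2 (g : E -> R) : bmeas g -> bmeas (fun w : E * E => g w.2).
  exact: bmeas_comp.
have [f1 f2] := hL _ _ bf ft.
have [Pf1 Pf2] : L (fun w => P f w.1) <= t /\ L (fun w => P f w.2) <= t.
  by apply: hL => // k; rewrite -iterSr; exact: ft.
split.
- rewrite (_ : swap_op _ _ _ = fun w => 2^-1 * (P f w.1 + f w.1)).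
    rewrite (mfZ mfL); last by apply: bmeasD; exact: b1.
    by rewrite (mfD mfL); [lra|exact: b1..].
  by apply/funext => w; rewrite swap_fst// mulrC.
- rewrite (_ : swap_op _ _ _ = fun w => 2^-1 * (P f w.2 + f w.2)).
    rewrite (mfZ mfL); last by apply: bmeasD; exact: b2.
    by rewrite (mfD mfL); [lra|exact: b2..].
  by apply/funext => w; rewrite swap_snd// mulrC.
Qed.

Definition diagonal_mean F : R := mean mu0 (fun x => F (x, x)).

Let bmeas_diagonal F : bmeas F -> bmeas (fun x => F (x, x)).
Proof.
by move=> bF; apply: (bmeas_comp (h := fun x : E => (x, x))) => //;
  exact: measurable_fun_pair.
Qed.

Lemma mean_functional_diagonal : mean_functional diagonal_mean.
Proof.
split=> [f g bf bg|k f bf|f bf f0|]; rewrite /diagonal_mean.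
- by rewrite meanD//; exact: bmeas_diagonal.
- by rewrite meanZ//; exact: bmeas_diagonal.
- exact: mean_ge0.
- exact: mean_cst.
Qed.

Lemma in_hull_diagonal : in_hull diagonal_mean.
Proof. by move=> f t bf ft; split; exact: (ft 0%N). Qed.

(** The synchronous coupling of nonexpansive maps never separates points. *)
Lemma op_capped_le r z :
  Q (fun w => capped_sqr r (w.1 - w.2)) z <= capped_sqr r (z.1 - z.2).
Proof.
apply: mean_le_cst.
  exact: (@bmeas_act _ _ _ (rm_pair rho) _ _ (bmeas_capped E r)).
move=> i /=; rewrite /capped_sqr le_min !ge_min lexx orbT andbT.
by rewrite ler_sqr ?nnegrE// (rm_averaged_nonexpansive c0).
Qed.

Section contradiction.
Variables (a eps M r : R).
Let q : E * E -> R := fun z => capped_sqr r (z.1 - z.2).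
Let H : E * E -> R := fun z => saturate M (z.1 - z.2).
(* A round gains 2 * delta. Half of it pays for the errors: delta / 4 for kappa,
   delta / 4 for the capped energy lost, delta / 2 for the escape cost. *)
Let delta := eps / (24 * M ^+ 2).
Hypotheses (eps0 : 0 < eps) (M0 : 0 < M) (aM : a <= M).
Hypothesis displaced : forall n k,
  eps <= expect k (displacement rho (rm_iter rho n) a).
Hypothesis escape_small : forall L, mean_functional L -> in_hull L ->
  L (fun z => escape_cost M r a z.1 z.2) <= delta / 2.

Let delta0 : 0 < delta.
Proof. by rewrite divr_gt0// mulr_gt0// exprn_gt0. Qed.

Let bq : bmeas q. Proof. exact: bmeas_capped. Qed.

Let iter_capped_le m n z : (m <= n)%N -> iter n Q q z <= iter m Q q z.
Proof.
move=> mn; rewrite -(subnKC mn) iterD; apply: le_iter_op => //.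
  exact: bmeas_iter_op.
elim: (n - m)%N => [|p IH] w //=.
apply: le_trans (op_capped_le r w).
by apply: le_op => //; exact: bmeas_iter_op.
Qed.

(** Among the times 0, m, 2m, ..., some interval of length m carries only a
    small part of the total energy loss, which is bounded. *)
Let quiet_interval L m eta J : mean_functional L -> (2 * r) ^+ 2 < eta * J%:R ->
  exists2 n, (n <= m * J)%N & L (iter n Q q) - L (iter (n + m) Q q) <= eta.
Proof.
move=> mfL etaJ; apply: contrapT => /forall2NP noJ.
have drop j : (j <= J)%N ->
    L (iter (m * j) Q q) <= (2 * r) ^+ 2 - eta * j%:R.
  elim: j => [_|j IH jJ].
    rewrite muln0 mulr0 subr0; apply: mf_le_cst => // z.
    exact: capped_sqr_le.
  have [] := noJ (m * j)%N.
    by rewrite leq_mul2l (ltnW jJ) orbT.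
  move/negP; rewrite -ltNge -mulnSr -natr1 => ?.
  by have := IH (ltnW jJ); lra.
have := drop J (leqnn _).
have : 0 <= L (iter (m * J) Q q).
  apply: (mf_ge0 mfL); first exact: bmeas_iter_op.
  by move=> z; apply: iter_op_ge0 => w; exact: capped_sqr_ge0.
by lra.
Qed.

(** N rounds bring the saturated energy up to N * delta. The length of the last
    round is known only once the law before it is, because it comes from
    quiet_interval; but it is bounded in advance, and the losses during it must
    already be small. Hence the induction provides smallness of the losses up to
    any prescribed time m. *)
Let rounds N m eta : 0 < eta -> exists L,
  [/\ mean_functional L, in_hull L, N%:R * delta <= L H &
      L q - L (iter m Q q) <= eta].
Proof.
elim: N m eta => [|N IH] m eta eta0.
  have mfd := mean_functional_diagonal; exists diagonal_mean; split => //.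
  - exact: in_hull_diagonal.
  - rewrite mul0r; apply: (mf_ge0 mfd); first exact: bmeas_saturate.
    by move=> z; exact: saturate_ge0.
  - apply: (@le_trans _ _ 0); last exact: ltW.
    rewrite subr_le0.
    have -> : diagonal_mean q = 0.
      rewrite /diagonal_mean -[RHS](mean_cst mu0 0); congr mean; apply/funext => x.
      by rewrite /q/= subrr /capped_sqr normr0 expr0n/= min_l// sqr_ge0.
    apply: (mf_ge0 mfd); first exact: bmeas_iter_op.
    by move=> z; apply: iter_op_ge0 => w; exact: capped_sqr_ge0.
have eta_arch := archi_boundP (divr_ge0 (sqr_ge0 (2 * r)) (ltW eta0)).
set J := Num.bound _ in eta_arch.
have etaJ : (2 * r) ^+ 2 < eta * J%:R by move: eta_arch; rewrite ltr_pdivrMr// (mulrC J%:R).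
pose kappa := delta / 4; have k0 : 0 < kappa by rewrite divr_gt0.
pose cmin := c / (m * J).+2%:R.
have cmin0 : 0 < cmin by rewrite divr_gt0.
pose eta1 := cmin * kappa * M ^+ 2 * (delta / 4).
have eta10 : 0 < eta1 by apply: mulr_gt0; [rewrite mulr_gt0 ?exprn_gt0// mulr_gt0|rewrite divr_gt0].
have [L [mfL hL LH Lq]] := IH (m * J).+1 eta1 eta10.
have mfL' := mean_functional_swap rho a mfL.
have hL' := in_hull_swap a mfL hL.
have [n nJ quiet] := quiet_interval m mfL' etaJ.
exists (fun F => L (swap_op rho a (iter n Q F))); split.
- exact: (@mean_functional_iter_op _ _ _ (rm_pair rho) n _ mfL').
- exact: (in_hull_iter_op n hL').
- have avg_n : rm_averaged (c / n.+2%:R) (rm_iter rho n).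
    apply: (@rm_averaged_le _ _ _ (c / n.+1%:R)); last exact: rm_averaged_iter.
    by rewrite ler_pM2l// lef_pV2 ?posrE// ler_nat.
  have cn0 : 0 < c / n.+2%:R by rewrite divr_gt0.
  have bth : bmeas (displacement rho (rm_iter rho n) a).
    exact: bmeas_displacement cn0 avg_n.
  have theta_ge : eps <= L (fun w => displacement rho (rm_iter rho n) a w.2).
    have le_eps k : expect k (fun x => - displacement rho (rm_iter rho n) a x) <= - eps.
      have mfk := mean_functional_iter_op rho k (mean_mean_functional mu0).
      by rewrite (mfN mfk)// lerN2; exact: displaced.
    have [_] := hL _ _ (bmeasN bth) le_eps.
    by rewrite (mfN mfL) ?lerN2//; exact: (bmeas_comp (h := snd)).
  have loss k : (k <= (m * J).+1)%N -> L q - L (iter k Q q) <= eta1.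
    move=> kJ; apply: le_trans Lq; rewrite lerD2l lerN2.
    apply: (mf_le mfL); [exact: bmeas_iter_op..|move=> z].
    exact: iter_capped_le.
  have := @one_round_gain _ _ _ rho c c0 avg_rho M r a kappa n M0 k0 aM L mfL.
  have := escape_small mfL hL.
  have := loss n (leqW nJ); have := loss n.+1 nJ.
  rewrite -/q -/H.
  set Lq0 := L q; set Lqn := L (iter n Q q); set LqS := L (iter n.+1 Q q).
  move=> l1 l2 le1 gain.
  have gain1 : 2 * delta <=
      L (fun w => displacement rho (rm_iter rho n) a w.2) * (12 * M ^+ 2)^-1.
    rewrite (_ : 2 * delta = eps * (12 * M ^+ 2)^-1); last first.
      by rewrite /delta; field; rewrite gt_eqF.
    by rewrite ler_pM2r// invr_gt0 mulr_gt0// exprn_gt0.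
  have loss1 : (2 * Lq0 - Lqn - LqS) *
      (2 * (c / n.+2%:R * kappa * M ^+ 2))^-1 <= delta / 4.
    rewrite ler_pdivrMr; last first.
      by rewrite mulr_gt0// mulr_gt0 ?exprn_gt0// mulr_gt0.
    apply: (@le_trans _ _ (2 * eta1)); first lra.
    have cc : cmin <= c / n.+2%:R.
      by rewrite ler_pM2l// lef_pV2 ?posrE// ler_nat !ltnS.
    have X0 : 0 <= kappa * M ^+ 2 * (delta / 4).
      by apply: mulr_ge0; [rewrite mulr_ge0 ?sqr_ge0// ltW|rewrite divr_ge0// ltW].
    have := ler_wpM2r X0 cc; rewrite /eta1.
    have -> : delta / 4 * (2 * (c / n.+2%:R * kappa * M ^+ 2)) =
      2 * (c / n.+2%:R * (kappa * M ^+ 2 * (delta / 4))) by ring.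
    have -> : 2 * (cmin * kappa * M ^+ 2 * (delta / 4)) =
      2 * (cmin * (kappa * M ^+ 2 * (delta / 4))) by ring.
    by rewrite ler_pM2l.
  rewrite -natr1 mulrDl mul1r; have kE : kappa = delta / 4 by []. lra.
- by rewrite -iterD.
Qed.

(** The saturated energy is at most 1, so the rounds cannot go on. *)
Lemma displacement_contradiction : False.
Proof.
have d0 : 0 <= delta^-1 by rewrite invr_ge0 ltW.
have := archi_boundP d0; set N := Num.bound _ => dN.
have [L [mfL _ LH _]] := rounds N 0 ltr01.
have : L H <= 1.
  by apply: mf_le_cst => [//||z]; [exact: bmeas_saturate|exact: saturate_le1].
rewrite leNgt => /negP; apply; apply: lt_le_trans LH.
by rewrite -ltr_pdivrMr// div1r.
Qed.

End contradiction.
End asymptotic_regularity.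

(** * Tightness and asymptotic regularity *)

Section regularity.
Context (R : realType) (d : measure_display) (E : euclideanType R d).
Implicit Types (x y : E) (f : E -> R).

Lemma tail_probability (mu : probability E R) (eta : R) : 0 < eta ->
  exists s, mean mu (far s) <= eta.
Proof.
move=> eta0.
have : (fun n : nat => mean mu (far n%:R)) @ \oo --> mean mu (fun=> 0 : R).
  apply: (@mean_cvg _ _ _ _ _ _ 1).
  - by move=> n; exact: bmeas_measurable (bmeas_far E _).
  - exact: bmeas_cst.
  - by move=> n x; rewrite ger0_norm ?far_ge0// /far lern1 leq_b1.
  move=> x; apply: cvg_near_cst; near=> n.
  apply/eqP; rewrite /far pnatr_eq0 eqb0 -leNgt.
  rewrite (@le_trans _ _ (Num.bound `|x|)%:R)//.
    by rewrite ltW// archi_boundP.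
  by rewrite ler_nat; near: n; exact: nbhs_infty_ge.
rewrite mean_cst => /cvgr_lt/(_ _ eta0) [N _ /(_ N (leqnn N))/ltW h].
by exists N%:R.
Unshelve. all: by end_near.
Qed.

Definition tight (rho : randmap R E) (mu : probability E R) : Prop :=
  forall eta, 0 < eta ->
    exists s, forall k, mean mu (iter k (op rho) (far s)) <= eta.

(** The chain started from mu0 stays within a fixed random distance of the
    stationary chain driven by the same maps. *)
Lemma tight_of_invariant (rho : randmap R E) (c : R) (mu0 pi : probability E R) :
  0 < c -> rm_averaged c rho ->
  (forall f, bmeas f -> mean pi (op rho f) = mean pi f) -> tight rho mu0.
Proof.
move=> c0 avg inv eta eta0.
have [s0 hs0] := @tail_probability mu0 (eta / 3) ltac:(by rewrite divr_gt0).
have [s1 hs1] := @tail_probability pi (eta / 3) ltac:(by rewrite divr_gt0).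
have [s [s0s s1s s_ge0]] : exists s, [/\ s0 <= s, s1 <= s & 0 <= s].
  exists (`|s0| + `|s1|); split; last exact: addr_ge0.
    by rewrite (le_trans (ler_norm _))// lerDl.
  by rewrite (le_trans (ler_norm _))// lerDr.
exists (4 * s) => k.
have invk f : bmeas f -> mean pi (iter k (op rho) f) = mean pi f.
  by move=> bf; elim: k => //= k <-; rewrite inv//; exact: bmeas_iter_op.
set sigma := rm_iter rho k.
have contr := rm_averaged_nonexpansive (divr_gt0 c0 (ltr0Sn R k))
  (rm_averaged_iter (n := k) c0 avg).
have point x y : iter k (op rho) (far (4 * s)) x <=
    iter k (op rho) (far (2 * s)) y + (far s x + far s y).
  rewrite -!op_iter; [|exact: bmeas_far..].
  rewrite -[far s x + _](mean_cst (rm_prob sigma)) -meanD; first last.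
    exact: bmeas_cst.
    exact/bmeas_act/bmeas_far.
  apply: le_mean.
  - exact/bmeas_act/bmeas_far.
  - by apply: bmeasD; [exact/bmeas_act/bmeas_far|exact: bmeas_cst].
  - move=> j; have -> : 4 * s = 2 * (2 * s) by ring.
    apply: (le_trans (far_split _ _ (rm_map j y))); rewrite lerD2l.
    apply: le_trans (far_subr s x y); rewrite /far ler_nat.
    case: ltP => // h; rewrite (lt_le_trans h)//; exact: contr.
have bk t : bmeas (iter k (op rho) (far t)) by apply/bmeas_iter_op/bmeas_far.
have step x : iter k (op rho) (far (4 * s)) x <= far s x +
    (mean pi (far (2 * s)) + mean pi (far s)).
  have bF t : bmeas (far t : E -> R) by exact: bmeas_far.
  have b1 := bmeasD (bk (2 * s)) (bF s).
  have := le_mean pi (bmeas_cst E (iter k (op rho) (far (4 * s)) x))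
    (bmeasD (bmeas_cst E (far s x)) b1) _.
  rewrite (meanD pi (bmeas_cst _ _) b1) (meanD pi (bk _) (bF _)) !mean_cst.
  by rewrite invk//; apply => y; have := point x y; lra.
have le_pi t : s1 <= t -> mean pi (far t) <= eta / 3.
  move=> s1t; apply: le_trans hs1; apply: le_mean; [exact: bmeas_far..|].
  by move=> x; exact: far_le.
have le_mu : mean mu0 (far s) <= eta / 3.
  apply: le_trans hs0; apply: le_mean; [exact: bmeas_far..|].
  by move=> x; exact: far_le.
apply: (@le_trans _ _ (mean mu0 (fun x => far s x +
    (mean pi (far (2 * s)) + mean pi (far s))))).
  by apply: le_mean => //; apply: bmeasD; [exact: bmeas_far|exact: bmeas_cst].
rewrite meanD ?mean_cst; [|exact: bmeas_far|exact: bmeas_cst].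
have := le_pi _ s1s; have := le_pi (2 * s) ltac:(lra).
lra.
Qed.

Variables (rho : randmap R E) (c : R) (mu0 : probability E R).
Hypotheses (c0 : 0 < c) (avg_rho : rm_averaged c rho) (tight_mu0 : tight rho mu0).
Notation P := (op rho).
Notation expect k f := (mean mu0 (iter k P f)).

(** Otherwise every round would gain a fixed amount of energy. Tightness makes the
    escape cost small: first the scale M is chosen, then delta, which depends on
    it, and then the scale r. *)
Lemma small_displacement a eps : 0 <= a -> 0 < eps ->
  exists n k, expect k (displacement rho (rm_iter rho n) a) < eps.
Proof.
move=> a0 eps0; apply: contrapT => no_small.
have displaced n k : eps <= expect k (displacement rho (rm_iter rho n) a).
  by rewrite leNgt; apply/negP => h; apply: no_small; exists n, k.
(* Chosen such that 13 * a ^+ 2 / M ^+ 2 * (2 * eta1) <= delta / 4. *)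
pose eta1 := eps / (a ^+ 2 + 1) / 48 / 52.
have a2 : 0 <= a ^+ 2 by exact: sqr_ge0.
have a21 : 0 < a ^+ 2 + 1 by lra.
have eta10 : 0 < eta1 by rewrite !divr_gt0.
have [s1 hs1] := tight_mu0 eta10.
pose M := 6 * `|s1| + a + 1.
have M0 : 0 < M by rewrite /M; have := normr_ge0 s1; lra.
have aM : a <= M by rewrite /M; have := normr_ge0 s1; lra.
have s1M : s1 <= M / 6.
  by apply: (le_trans (ler_norm _)); rewrite /M; lra.
pose delta := eps / (24 * M ^+ 2).
have M2 : 0 < M ^+ 2 by rewrite exprn_gt0.
have delta0 : 0 < delta by rewrite divr_gt0// mulr_gt0.
have [r hr] := tight_mu0 (divr_gt0 delta0 (ltr0Sn R 15)).
apply: (displacement_contradiction c0 avg_rho (r := r) eps0 M0 aM displaced).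
move=> L mfL hL; rewrite -/delta.
have bf1 t : bmeas (fun w : E * E => far t w.1).
  exact: (bmeas_comp (h := fst)) (bmeas_far E t).
have bf2 t : bmeas (fun w : E * E => far t w.2).
  exact: (bmeas_comp (h := snd)) (bmeas_far E t).
have [M1' M2'] : L (fun w => far (M / 6) w.1) <= eta1 /\
    L (fun w => far (M / 6) w.2) <= eta1.
  apply: hL; first exact: bmeas_far.
  move=> k; apply: le_trans (hs1 k); apply: le_mean.
  - exact/bmeas_iter_op/bmeas_far.
  - exact/bmeas_iter_op/bmeas_far.
  - by apply: le_iter_op; [exact: bmeas_far..|move=> x; exact: far_le].
have [r1 r2] := hL _ _ (bmeas_far E r) hr.
pose C1 := 13 * a ^+ 2 / M ^+ 2.
have bM : bmeas (fun w : E * E => far (M / 6) w.1 + far (M / 6) w.2).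
  exact: bmeasD.
have br : bmeas (fun w : E * E => far r w.1 + far r w.2) by exact: bmeasD.
rewrite (_ : (fun z => _) = fun w => C1 * (far (M / 6) w.1 + far (M / 6) w.2) +
  2 * (far r w.1 + far r w.2))//.
rewrite (mfD mfL (bmeasZ _ bM) (bmeasZ _ br)) !(mfZ mfL)// !(mfD mfL)// /C1.
have : 13 * a ^+ 2 / M ^+ 2 * (L (fun w => far (M / 6) w.1) +
    L (fun w => far (M / 6) w.2)) <= delta / 4.
  apply: (@le_trans _ _ (13 * a ^+ 2 / M ^+ 2 * (2 * eta1))).
    apply: ler_wpM2l; last lra.
    by apply: divr_ge0; [exact: mulr_ge0|exact: ltW].
  have -> : 13 * a ^+ 2 / M ^+ 2 * (2 * eta1) =
      delta / 4 * (a ^+ 2 / (a ^+ 2 + 1)).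
    rewrite /eta1 /delta; field; rewrite gt_eqF//=; lra.
  rewrite ler_piMr//; first by rewrite divr_ge0// ltW.
  by rewrite ler_pdivrMr ?mul1r ?lerDl//; lra.
lra.
Qed.

(** The operator of a nonexpansive random map preserves this class of test
    functions, so that estimates uniform over the class persist in time. *)
Definition bounded_lipschitz (K : R) f : Prop :=
  (forall x, `|f x| <= 1) /\ forall x y, `|f x - f y| <= K * `|x - y|.

Lemma bounded_lipschitz_continuous K f : bounded_lipschitz K f -> continuous f.
Proof.
move=> [_ fK] x; apply/cvgrPdist_le => e e0.
have K1 : 0 < `|K| + 1 by rewrite ltr_wpDl.
near=> y.
apply: (le_trans (fK _ _)); apply: (@le_trans _ _ ((`|K| + 1) * `|x - y|)).
  by rewrite ler_wpM2r// (le_trans (ler_norm _))// lerDl.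
rewrite -ler_pdivlMl// mulrC; near: y.
apply: cvgr_dist_le; last by rewrite divr_gt0.
exact: cvg_id.
Unshelve. all: by end_near.
Qed.

Lemma bmeas_bounded_lipschitz K f : bounded_lipschitz K f -> bmeas f.
Proof.
move=> h; split; last by exists 1; exact: h.1.
exact/continuous_measurable_euclidean/bounded_lipschitz_continuous/h.
Qed.

Lemma bounded_lipschitzN K f : bounded_lipschitz K f ->
  bounded_lipschitz K (fun x => - f x).
Proof.
move=> [f1 fK]; split=> [x|x y]; first by rewrite normrN.
by rewrite -opprD normrN.
Qed.

Lemma bounded_lipschitz_op K f : 0 <= K -> bounded_lipschitz K f ->
  bounded_lipschitz K (P f).
Proof.
move=> K0 h; have bf := bmeas_bounded_lipschitz h; have [f1 fK] := h.
split=> [x|x y]; first by apply: mean_norm_le => //; exact: bmeas_act.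
rewrite -meanB; [|exact: bmeas_act..].
apply: mean_norm_le; first by apply: bmeasB; exact: bmeas_act.
move=> i; apply: (le_trans (fK _ _)); rewrite ler_wpM2l//.
exact: (rm_averaged_nonexpansive c0 avg_rho).
Qed.

Lemma bounded_lipschitz_iter_op K f k : 0 <= K -> bounded_lipschitz K f ->
  bounded_lipschitz K (iter k P f).
Proof. by move=> K0 h; elim: k => //= k IH; exact: bounded_lipschitz_op. Qed.

(** If the first step T moves y little, the increment of f is at most K times the
    distance of the images of T y and y, whose mean square is the
    displacement. *)
Let one_step s K kappa n f y : 0 < kappa -> bounded_lipschitz K f ->
  iter n.+1 P f y - iter n P f y <=
  2 * P (far s) y + 2 * far s y + kappa +
  K ^+ 2 / kappa * displacement rho (rm_iter rho n) (2 * s) y.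
Proof.
move=> k0 h; have bf := bmeas_bounded_lipschitz h; have [f1 fK] := h.
have cn0 : 0 < c / n.+1%:R by rewrite divr_gt0.
have avg_n := rm_averaged_iter (n := n) c0 avg_rho.
have bPn : bmeas (iter n P f) by exact: bmeas_iter_op.
rewrite iterS /op.
rewrite -(mean_cst (rm_prob rho) (iter n (op rho) f y)).
rewrite -meanB; [|exact: bmeas_act|exact: bmeas_cst].
pose th i := mean (rm_prob (rm_iter rho n)) (fun j =>
    if `|rm_map (r := rho) i y - y| <= 2 * s
    then `|rm_map j (rm_map i y) - rm_map j y| ^+ 2 else 0).
have bth : bmeas th by exact: (bmeas_displacement_outer rho _ cn0 avg_n).
have bfar : bmeas (fun i : rm_space rho => far s (rm_map i y)).
  exact/bmeas_act/bmeas_far.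
have b1 := bmeasZ 2 bfar.
have bc (C : R) : bmeas (fun _ : rm_space rho => C) by exact: bmeas_cst.
have b2 := bmeasD b1 (bc (2 * far s y)); have b3 := bmeasD b2 (bc kappa).
have b4 := bmeasZ (K ^+ 2 / kappa) bth.
apply: (@le_trans _ _ (mean (rm_prob rho) (fun i =>
    2 * far s (rm_map i y) + 2 * far s y + kappa + K ^+ 2 / kappa * th i))).
  2: by rewrite (meanD _ b3 b4) (meanD _ b2 (bc _)) (meanD _ b1 (bc _))
    !meanZ// !mean_cst.
apply: le_mean; [|exact: bmeasD b3 b4|move=> i].
  by apply: bmeasB => //; exact: bmeas_act.
rewrite -op_iter// /op -meanB; [|exact: bmeas_act..].
rewrite /th -meanZ; last exact: (bmeas_displacement_inner _ cn0 avg_n).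
rewrite -[2 * far s _ + _ + _](mean_cst (rm_prob (rm_iter rho n))) -meanD; first last.
- exact/bmeasZ/(bmeas_displacement_inner _ cn0 avg_n).
- exact: bmeas_cst.
apply: le_mean.
- by apply: bmeasB; exact: bmeas_act.
- apply: bmeasD; first exact: bmeas_cst.
  exact/bmeasZ/(bmeas_displacement_inner _ cn0 avg_n).
move=> j; set u := rm_map j (rm_map i y); set v := rm_map j y.
have F0 := far_ge0 s (rm_map i y); have F1 := far_ge0 s y.
have [near|fara] := leP `|rm_map i y - y| (2 * s); last first.
  have := far_subr s (rm_map i y) y; rewrite {1}/far fara /= mulr0 addr0.
  have := f1 u; have := f1 v; rewrite !ler_norml => /andP[? ?] /andP[? ?]; lra.
set t := K * `|u - v|.
have ft : f u - f v <= t by exact: le_trans (ler_norm _) (fK _ _).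
have -> : K ^+ 2 / kappa * `|u - v| ^+ 2 = t ^+ 2 / kappa by rewrite /t; field; rewrite gt_eqF.
by have := le_add_sqr_div t k0; lra.
Qed.

(** It suffices that the increments are small at one time: later increments of f
    are increments at that time of an iterate of f, which is in the same
    class. *)
Lemma asymptotic_regularity K eps : 0 <= K -> 0 < eps ->
  exists N, forall n, (N <= n)%N -> forall f, bounded_lipschitz K f ->
    `|expect n.+1 f - expect n f| <= eps.
Proof.
move=> K0 eps0.
have eta0 : 0 < eps / 12 by rewrite divr_gt0.
have [s0 hs0] := tight_mu0 eta0.
pose s := `|s0|.
have hs k : expect k (far s) <= eps / 12.
  apply: le_trans (hs0 k); apply: le_mean; [exact/bmeas_iter_op/bmeas_far..|].
  by apply: le_iter_op; [exact: bmeas_far..|move=> x; exact/far_le/ler_norm].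
pose kappa := eps / 3; have k0 : 0 < kappa by rewrite divr_gt0.
pose K2 := K ^+ 2 / kappa.
have K20 : 0 <= K2 by rewrite divr_ge0 ?sqr_ge0// ltW.
have e1 : 0 < eps / (3 * (K2 + 1)) by rewrite divr_gt0// mulr_gt0//; lra.
have s20 : 0 <= 2 * s by rewrite mulr_ge0// normr_ge0.
have [n [k hnk]] := small_displacement s20 e1.
have cn0 : 0 < c / n.+1%:R by rewrite divr_gt0.
have bth : bmeas (displacement rho (rm_iter rho n) (2 * s)).
  exact: (bmeas_displacement rho _ cn0 (rm_averaged_iter (n := n) c0 avg_rho)).
have one_sided f : bounded_lipschitz K f ->
    expect (k + n).+1 f - expect (k + n) f <= eps.
  move=> h; have bf := bmeas_bounded_lipschitz h.
  have mfk := mean_functional_iter_op rho k (mean_mean_functional mu0).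
  rewrite -addnS !iterD -(mfB mfk); [|exact: bmeas_iter_op..].
  have bF := bmeas_far E s.
  have bPF := bmeas_op rho bF.
  have bc : bmeas (fun _ : E => kappa) by exact: bmeas_cst.
  have b1 : bmeas (fun y => 2 * P (far s) y + 2 * far s y).
    by apply: bmeasD; exact: bmeasZ.
  have b2 : bmeas (fun y => 2 * P (far s) y + 2 * far s y + kappa).
    exact: bmeasD.
  have b3 := bmeasZ K2 bth.
  apply: (le_trans (mf_le mfk _ (bmeasD b2 b3)
    (fun y => one_step s n y k0 h))).
    by apply: bmeasB; exact: bmeas_iter_op.
  rewrite (mfD mfk b2 b3) (mfD mfk b1 bc) (mfD mfk (bmeasZ 2 bPF) (bmeasZ 2 bF)).
  rewrite (mf_cst mfk) !(mfZ mfk)// -iterSr.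
  have := hs k; have := hs k.+1.
  have : K2 * expect k (displacement rho (rm_iter rho n) (2 * s)) <= eps / 3.
    apply: (@le_trans _ _ (K2 * (eps / (3 * (K2 + 1))))).
      by rewrite ler_wpM2l// ltW.
    have -> : K2 * (eps / (3 * (K2 + 1))) = eps / 3 * (K2 / (K2 + 1)).
      by field; lra.
    rewrite ler_piMr ?divr_ge0 ?(ltW eps0)//.
    by rewrite ler_pdivrMr ?mul1r ?lerDl//; lra.
  rewrite /kappa; lra.
exists (k + n)%N => m mN f h.
have hg := bounded_lipschitz_iter_op (m - (k + n)) K0 h.
have bg := bmeas_bounded_lipschitz hg.
rewrite -(subnKC mN) -addSn (iterD (k + n).+1) (iterD (k + n)); set g := iter (m - _) _ f in hg bg *.
rewrite ler_norml; apply/andP; split; last exact: one_sided.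
have := one_sided _ (bounded_lipschitzN hg).
rewrite (mfN (mean_functional_iter_op rho _ (mean_mean_functional mu0)) bg).
rewrite (mfN (mean_functional_iter_op rho _ (mean_mean_functional mu0)) bg).
by lra.
Qed.

End regularity.

(** * Lipschitz approximations of open sets *)

Section truncated_distance.
Context (R : realType) (d : measure_display) (E : euclideanType R d).
Implicit Types (x y : E) (A U : set E).

(** Distance to A truncated at 1, so that it is also meaningful for A empty. *)
Definition tdist A x : R := inf ([set 1] `|` [set `|x - a| | a in A]).

Let has_inf_tdist A x : has_inf ([set 1] `|` [set `|x - a| | a in A]).
Proof.
split; first by exists 1; left.
by exists 0 => _ [->|[a _ <-]].
Qed.

Lemma tdist_ge0 A x : 0 <= tdist A x.
Proof.
by apply: lb_le_inf; [exact: (has_inf_tdist A x).1|move=> _ [->|[a _ <-]]].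
Qed.

Lemma tdist_le1 A x : tdist A x <= 1.
Proof. by apply: ge_inf; [exact: (has_inf_tdist A x).2|left]. Qed.

Lemma tdist_le A x a : A a -> tdist A x <= `|x - a|.
Proof.
by move=> Aa; apply: ge_inf; [exact: (has_inf_tdist A x).2|right; exists a].
Qed.

Lemma tdist_lipschitz A x y : `|tdist A x - tdist A y| <= `|x - y|.
Proof.
have half u v : tdist A u <= tdist A v + `|u - v|.
  rewrite -lerBlDr; apply: lb_le_inf; first exact: (has_inf_tdist A v).1.
  move=> _ [->|[a Aa <-]]; rewrite lerBlDr.
    by rewrite (le_trans (tdist_le1 _ _))// lerDl.
  apply: (le_trans (tdist_le u Aa)).
  by rewrite [leRHS]addrC; exact: ler_distD.
have := half x y; have := half y x; rewrite distrC ler_norml => *; lra.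
Qed.

Lemma tdist_in A x : A x -> tdist A x = 0.
Proof.
move=> Ax; apply/eqP; rewrite eq_le tdist_ge0 andbT.
by rewrite (le_trans (tdist_le x Ax))// subrr normr0.
Qed.

Lemma tdist_lt A x e : e <= 1 -> tdist A x < e -> exists2 a, A a & `|x - a| < e.
Proof.
move=> e1 /(inf_lt (has_inf_tdist A x).1) [_ [->|[a Aa <-]]].
  by rewrite ltNge e1.
by exists a.
Qed.

Lemma tdist_gt0 U x : open U -> U x -> 0 < tdist (~` U) x.
Proof.
move=> oU Ux; have /nbhs_ballP[e /= e0 xe] := open_nbhs_nbhs (conj oU Ux).
apply: (@lt_le_trans _ _ (Num.min 1 e)); first by rewrite lt_min ltr01.
apply: lb_le_inf; first exact: (has_inf_tdist _ x).1.
move=> _ [->|[a Ua <-]]; first by rewrite ge_min lexx.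
rewrite ge_min; apply/orP; right; rewrite leNgt; apply/negP => xa.
by apply: Ua; apply: xe; rewrite -ball_normE.
Qed.

(** Lipschitz functions increasing to the indicator of the open set U. *)
Definition ramp U (k : nat) x : R := Num.min 1 (k%:R * tdist (~` U) x).

Lemma ramp_ge0 U k x : 0 <= ramp U k x.
Proof. by rewrite /ramp le_min ler01 mulr_ge0// tdist_ge0. Qed.

Lemma ramp_le1 U k x : ramp U k x <= 1.
Proof. by rewrite /ramp ge_min lexx. Qed.

Lemma ramp_out U k x : ~ U x -> ramp U k x = 0.
Proof. by move=> Ux; rewrite /ramp tdist_in// mulr0 min_r. Qed.

Lemma ramp_le U j k x : (j <= k)%N -> ramp U j x <= ramp U k x.
Proof.
move=> jk; rewrite /ramp le_min !ge_min lexx/=.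
by rewrite ler_wpM2r ?orbT ?tdist_ge0// ler_nat.
Qed.

Lemma ramp_eq1 U x : open U -> U x -> exists j, forall k, (j <= k)%N -> ramp U k x = 1.
Proof.
move=> oU Ux; have t0 := tdist_gt0 oU Ux.
exists (Num.bound (tdist (~` U) x)^-1) => k jk.
rewrite /ramp min_l// -ler_pdivrMr// div1r ltW//.
apply: (@lt_le_trans _ _ (Num.bound (tdist (~` U) x)^-1)%:R).
  by rewrite archi_boundP// invr_ge0 ltW.
by rewrite ler_nat.
Qed.

Lemma bounded_lipschitz_ramp U k : bounded_lipschitz k%:R (ramp U k).
Proof.
split=> [x|x y]; first by rewrite ger0_norm ?ramp_ge0 ?ramp_le1.
have half u v : ramp U k u <= ramp U k v + k%:R * `|u - v|.
  have kt : k%:R * tdist (~` U) u <= k%:R * tdist (~` U) v + k%:R * `|u - v|.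
    rewrite -mulrDr ler_wpM2l//; have := tdist_lipschitz (~` U) u v.
    by rewrite ler_norml => /andP[_]; lra.
  have n0 : 0 <= k%:R * `|u - v| by rewrite mulr_ge0.
  rewrite /ramp -lerBlDr le_min !lerBlDr.
  by rewrite !ge_min lerDl n0 kt orbT.
have := half x y; have := half y x; rewrite distrC ler_norml => *; lra.
Qed.

(** The ramps of U increase to its indicator, and the open sets form a pi-system
    generating the Borel sets. *)
Lemma probability_eq_ramp (mu nu : probability E R) :
  (forall U k, open U -> mean mu (ramp U k) = mean nu (ramp U k)) ->
  forall A, measurable A -> mu A = nu A.
Proof.
move=> munu; apply: (measure_unique (@open E) (fun=> setT)).
- exact: measurable_borel.
- exact: openI.
- by move=> _; exact: openT.
- by rewrite bigcup_const.
- move=> U oU; have mU := open_measurable_euclidean oU.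
  have limU (m : probability E R) :
      (fun k => mean m (ramp U k)) @ \oo --> mean m (\1_U).
    apply: (@mean_cvg _ _ _ _ _ _ 1).
    + by move=> k; exact: bmeas_measurable (bmeas_bounded_lipschitz (bounded_lipschitz_ramp U k)).
    + exact: bmeas_indic.
    + by move=> k x; rewrite ger0_norm ?ramp_ge0 ?ramp_le1.
    + move=> x; apply: cvg_near_cst; rewrite indicE.
      have [Ux|Ux] := pselect (U x).
        have [j jk] := ramp_eq1 oU Ux; exists j => // k /= /jk ->.
        by rewrite mem_set.
      by apply: nearW => k; rewrite ramp_out// memNset.
  apply: etrans (esym (mean_indic mu mU)) (etrans _ (mean_indic nu mU)).
  congr EFin.
  have c1 := limU mu; have c2 := limU nu.
  have e : (fun k => mean mu (ramp U k)) = (fun k => mean nu (ramp U k)).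
    by apply/funext => k; exact: munu.
  by rewrite e in c1; exact: cvg_unique c1 c2.
- by move=> k; rewrite [X in (X < _)%E]probability_setT ltry.
Qed.

End truncated_distance.

(** * Riesz representation of tight functionals *)

Section riesz.
Context (R : realType) (d : measure_display) (E : euclideanType R d).
Variable L : (E -> R) -> R.
Hypotheses (mfL : mean_functional L)
  (tightL : forall eta, 0 < eta -> exists s, L (far s) <= eta).
Implicit Types (f : E -> R) (A U : set E).

Definition nonneg_cb f : Prop :=
  [/\ continuous f, forall x, 0 <= f x & exists C, forall x, f x <= C].

Let nonneg_cb_bmeas f : nonneg_cb f -> bmeas f.
Proof.
move=> [cf f0 [C fC]]; apply: (@bmeas_between _ _ _ _ 0 C).
  exact: continuous_measurable_euclidean.
by move=> x; rewrite f0 fC.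
Qed.

Let nonneg_cb_cst c : 0 <= c -> nonneg_cb (fun=> c).
Proof. by move=> c0; split=> //; [move=> x; exact: cvg_cst|exists c]. Qed.

Let nonneg_cbM f (g : E -> R) : nonneg_cb f -> nonneg_cb g -> nonneg_cb (fun x => f x * g x).
Proof.
move=> [cf f0 [C fC]] [cg g0 [D gD]]; split=> [x|x|].
- by apply: cvgM; [exact: cf|exact: cg].
- exact: mulr_ge0.
- by exists (C * D) => x; exact: ler_pM.
Qed.

Let nonneg_cb_sum (I : Type) (s : seq I) (F : I -> E -> R) :
  (forall i, nonneg_cb (F i)) -> nonneg_cb (fun x => \sum_(i <- s) F i x).
Proof.
move=> cF; split=> [|x|].
- by apply: (continuous_big add_continuous) => i _; have [] := cF i.
- by apply: sumr_ge0 => i _; have [] := cF i.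
- elim: s => [|i s [C sC]]; first by exists 0 => x; rewrite big_nil.
  have [_ _ [D FD]] := cF i.
  by exists (D + C) => x; rewrite big_cons lerD.
Qed.

(** Dini's theorem, with the tightness of L taking care of the complement of a
    compact ball. *)
Lemma dini (f_ : nat -> E -> R) (C : R) :
  (forall n, continuous (f_ n)) -> (forall n x, 0 <= f_ n x <= C) ->
  (forall n x, f_ n.+1 x <= f_ n x) ->
  (forall x e, 0 < e -> exists n, f_ n x < e) ->
  forall e, 0 < e -> exists n, L (f_ n) <= e.
Proof.
move=> cf fC df f0 e e0.
have dec m n x : (m <= n)%N -> f_ n x <= f_ m x.
  by move=> /subnK <-; elim: (n - m)%N => // k; apply: le_trans; rewrite addSn.
have C0 : 0 <= C by have /andP[h1 h2] := fC 0%N 0; exact: le_trans h2.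
have e1 : 0 < e / (2 * (C + 1)) by rewrite divr_gt0// mulr_gt0//; lra.
have [s Ls] := tightL e1.
have e2 : 0 < e / 2 by rewrite divr_gt0.
have /compact_near_coveringP/(_ nat \oo (fun n x => f_ n x <= e / 2)) :=
  @compact_norm_le R d E s.
case.
  move=> x _; have [n fn] := f0 x _ e2.
  have fx : \forall x' \near x, f_ n x' < e / 2.
    exact: (cvgr_lt (f_ n x) (cf n x)).
  exists ([set x' | f_ n x' < e / 2], [set k | (n <= k)%N]).
    by split => //=; exists n.
  by move=> [x' k] /= [x'e nk]; apply: le_trans (ltW x'e); exact: dec.
move=> N _ /(_ N (leqnn N)) NK; exists N.
have bfar := bmeas_far E s.
apply: (@le_trans _ _ (L (fun x => e / 2 + C * far s x))).
  apply: (mf_le mfL).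
  - apply: (@bmeas_between _ _ _ _ 0 C (continuous_measurable_euclidean (cf N))).
    exact: fC.
  - by apply: bmeasD; [exact: bmeas_cst|exact: bmeasZ].
  - move=> x; have [xs|xs] := leP `|x| s.
      by apply: (le_trans (NK _ xs)); rewrite lerDl mulr_ge0.
    have /andP[_ fNC] := fC N x.
    by rewrite /far xs mulr1 (le_trans fNC)// lerDr ltW.
rewrite (mfD mfL); [|exact: bmeas_cst|exact: bmeasZ].
rewrite (mf_cst mfL) (mfZ mfL)//.
have : C * L (far s) <= e / 2.
  apply: (@le_trans _ _ (C * (e / (2 * (C + 1))))); first exact: ler_wpM2l.
  have -> : C * (e / (2 * (C + 1))) = e / 2 * (C / (C + 1)) by field; lra.
  rewrite ler_piMr ?(ltW e2)// ler_pdivrMr ?mul1r ?lerDl//; lra.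
lra.
Qed.

Definition covered A (g : nat -> E -> R) (t : R) : Prop :=
  [/\ forall n, nonneg_cb (g n), forall n x, g n x <= g n.+1 x,
      forall x, A x -> exists n, 1 <= g n x & forall n, L (g n) <= t].

Let covered_le A (g : nat -> E -> R) m n x t : covered A g t -> (m <= n)%N -> g m x <= g n x.
Proof.
move=> [_ gi _ _] /subnK <-; elim: (n - m)%N => // k IH.
by rewrite addSn (le_trans IH).
Qed.

(** Daniell's extension of L, built from increasing sequences of continuous
    functions, which makes countable subadditivity hold. *)
Definition outer A : R := inf [set t | exists g, covered A g t].

Let covered1 A : covered A (fun _ _ => 1) 1.
Proof.
split=> //; [by move=> _; exact: nonneg_cb_cst|by move=> x _; exists 0%N|].
by move=> _; rewrite (mf1 mfL).
Qed.

Let covered_ge0 A (g : nat -> E -> R) t : covered A g t -> 0 <= t.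
Proof.
move=> [cg _ _ gt]; apply: le_trans (gt 0%N); apply: (mf_ge0 mfL).
  exact: nonneg_cb_bmeas.
by have [] := cg 0%N.
Qed.

Let has_inf_outer A : has_inf [set t | exists g, covered A g t].
Proof.
split; first by exists 1; eexists; exact: covered1.
by exists 0 => t [g /covered_ge0].
Qed.

Lemma outer_le A (g : nat -> E -> R) t : covered A g t -> outer A <= t.
Proof. by move=> h; apply: ge_inf; [exact: (has_inf_outer A).2|exists g]. Qed.

Lemma outer_ge0 A : 0 <= outer A.
Proof.
apply: lb_le_inf; first exact: (has_inf_outer A).1.
by move=> t [g /covered_ge0].
Qed.

Lemma outer_le1 A : outer A <= 1.
Proof. exact: outer_le (covered1 A). Qed.

Lemma outer_approx A e : 0 < e -> exists g, covered A g (outer A + e).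
Proof.
move=> e0; have [t [g [g1 g2 g3 g4]] te] := inf_adherent e0 (has_inf_outer A).
by exists g; split=> // n; exact: le_trans (g4 n) (ltW te).
Qed.

(** A sequence covering A dominates f only in the limit; dini allows stopping it
    at a finite stage. *)
Lemma le_outer A f : continuous f -> (forall x, 0 <= f x <= 1) ->
  (forall x, ~ A x -> f x = 0) -> L f <= outer A.
Proof.
move=> cf f01 fA; apply/ler_addgt0Pr => e e0.
have [g cov] := outer_approx A (divr_gt0 e0 (ltr0Sn R 1)).
have [cg gi gA gL] := cov.
have bf : bmeas f.
  exact: bmeas_between (continuous_measurable_euclidean cf) f01.
have cmin n : continuous (fun x => Num.min (f x) (g n x)).
  have [cgn _ _] := cg n.
  by move=> x; apply: continuous_min; [exact: cf|exact: cgn].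
have bmin n : bmeas (fun x => Num.min (f x) (g n x)).
  apply: (@bmeas_between _ _ _ _ 0 1 (continuous_measurable_euclidean (cmin n))).
  move=> x; have /andP[fx0 fx1] := f01 x; have [_ g0 _] := cg n.
  by rewrite le_min fx0 g0 ge_min fx1.
have [n hn] : exists n, L (fun x => f x - Num.min (f x) (g n x)) <= e / 2.
  apply: (@dini _ 1) => //.
  - by move=> n x; apply: cvgB; [exact: cf|exact: cmin].
  - move=> n x; have /andP[fx0 fx1] := f01 x; have [_ g0 _] := cg n.
    rewrite subr_ge0 ge_min lexx/= lerBlDr (le_trans fx1)// lerDl le_min fx0.
    exact: g0.
  - move=> n x; rewrite lerD2l lerN2 le_min !ge_min lexx/=.
    by rewrite gi orbT.
  - move=> x eps eps0; have [Ax|/fA fx] := pselect (A x); last first.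
      by exists 0%N; have [_ g0 _] := cg 0%N; rewrite fx min_l// subrr.
    have [n gn] := gA x Ax; exists n; rewrite min_l ?subrr//.
    by have /andP[_ fx1] := f01 x; exact: le_trans gn.
  - by rewrite divr_gt0.
rewrite (mfB mfL bf (bmin n)) in hn.
have : L (fun x => Num.min (f x) (g n x)) <= L (g n).
  apply: (mf_le mfL) => //; first exact: nonneg_cb_bmeas.
  by move=> x; rewrite ge_min lexx orbT.
by have := gL n; lra.
Qed.

Lemma outer_le_of_ge1 A f : nonneg_cb f -> (forall x, A x -> 1 <= f x) ->
  outer A <= L f.
Proof.
move=> cf fA; apply: (@outer_le _ (fun _ => f)).
by split=> // x Ax; exists 0%N; exact: fA.
Qed.

Definition outer_ext A : \bar R := (outer A)%:E.

Let outer_ext0 : outer_ext set0 = 0%E.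
Proof.
congr EFin; apply/eqP; rewrite eq_le outer_ge0 andbT.
have c0 : nonneg_cb (fun _ : E => 0) by exact: nonneg_cb_cst.
by apply: (le_trans (outer_le_of_ge1 c0 _)) => //; rewrite (mf_cst mfL).
Qed.

Let outer_ext_ge0 A : (0 <= outer_ext A)%E.
Proof. by rewrite lee_fin outer_ge0. Qed.

Let le_outer_ext : {homo outer_ext : A B / A `<=` B >-> (A <= B)%E}.
Proof.
move=> A B AB; rewrite lee_fin; apply/ler_addgt0Pr => e e0.
have [g [g1 g2 g3 g4]] := outer_approx B e0.
by apply: (@outer_le _ g); split=> // x /AB; exact: g3.
Qed.

Let geometric_sum (e : R) n : 0 <= e ->
  \sum_(i < n) e / 2 ^+ i.+1 <= e.
Proof.
move=> e0; suff -> : \sum_(i < n) e / 2 ^+ i.+1 = e - e / 2 ^+ n.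
  by rewrite gerBl divr_ge0// exprn_ge0.
elim: n => [|n IH]; first by rewrite big_ord0 expr0 divr1 subrr.
rewrite big_ord_recr/= IH exprS; field.
by rewrite expf_neq0.
Qed.

Let outer_ext_sigma_subadditive : sigma_subadditive outer_ext.
Proof.
move=> F; set S := (\sum_(i <oo) _)%E.
have S0 : (0 <= S)%E by apply: nneseries_ge0 => n _ _; exact: outer_ext_ge0.
have [->|Sfin] := eqVneq S +oo%E; first exact: leey.
have Sreal : S = (fine S)%:E by rewrite fineK// ge0_fin_numE// ltey.
have partial n : \sum_(i < n) outer (F i) <= fine S.
  rewrite -lee_fin -Sreal -sumEFin.
  have := @nneseries_lim_ge R (outer_ext \o F) xpredT 0 n.
  by rewrite big_mkord; apply => i _ _; exact: outer_ext_ge0.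
rewrite Sreal lee_fin; apply/ler_addgt0Pr => e e0.
have e2 i : 0 < e / 2 ^+ i.+1 by rewrite divr_gt0// exprn_gt0.
have [G cG] := choice (fun i => outer_approx (F i) (e2 i)).
apply: (@outer_le _ (fun n x => \sum_(i < n.+1) G i n x)); split.
- by move=> n; apply: nonneg_cb_sum => i; have [] := cG i.
- move=> n x; rewrite [leRHS]big_ord_recr/=; apply: ler_wpDr.
    by have [+ _ _ _] := cG n.+1 => /(_ n.+1)[].
  by apply: ler_sum => i _; have [_ + _ _] := cG i; exact.
- move=> x [i _ Fx]; have [_ _ /(_ _ Fx)[n gn] _] := cG i.
  exists (maxn i n); have im : (i < (maxn i n).+1)%N by rewrite ltnS leq_maxl.
  rewrite (bigD1 (Ordinal im))//=; apply: ler_wpDr.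
    by apply: sumr_ge0 => j _; have [+ _ _ _] := cG j => /(_ (maxn i n))[].
  by apply: (le_trans gn); apply: covered_le (cG i) _; exact: leq_maxr.
- move=> n.
  rewrite (mf_sum mfL); last first.
    by move=> i; apply: nonneg_cb_bmeas; have [] := cG i.
  apply: (@le_trans _ _
      (\sum_(i < n.+1) (outer (F i) + e / 2 ^+ i.+1))).
    by apply: ler_sum => i _; have [_ _ _] := cG i; exact.
  rewrite big_split; apply: lerD; first exact: partial.
  by apply: geometric_sum; exact: ltW.
Qed.

HB.instance Definition _ := isOuterMeasure.Build R E outer_ext
  outer_ext0 outer_ext_ge0 le_outer_ext outer_ext_sigma_subadditive.

(** A covering g of A splits into the products of g with ramp U and with
    1 - ramp U, which cover the parts of A inside and outside U. *)
Lemma caratheodory_open U : open U -> (outer_ext : outer_measure R E).-caratheodory U.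
Proof.
move=> oU; apply: le_caratheodory_measurable => A; rewrite -EFinD lee_fin.
apply/ler_addgt0Pr => e e0; have [g cov] := outer_approx A e0.
have [cg gi gA gL] := cov; set t := outer A + e in cov gL *.
have cr k : nonneg_cb (ramp U k).
  split; [exact: bounded_lipschitz_continuous (bounded_lipschitz_ramp U k)| |].
    by move=> x; exact: ramp_ge0.
  by exists 1 => x; exact: ramp_le1.
have cr' k : nonneg_cb (fun x => 1 - ramp U k x).
  split; last by exists 1 => x; rewrite gerBl ramp_ge0.
    by move=> x; apply: cvgB; [exact: cvg_cst|have [+ _ _] := cr k; exact].
  by move=> x; rewrite subr_ge0 ramp_le1.
have in_le k : L (fun x => g k x * ramp U k x) <= t - outer (A `&` ~` U).
  rewrite lerBrDl -lerBrDr.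
  apply: (@outer_le _ (fun n x => g (n + k)%N x * (1 - ramp U k x))); split.
  - by move=> n; apply: nonneg_cbM.
  - by move=> n x; rewrite ler_wpM2r ?subr_ge0 ?ramp_le1// gi.
  - move=> x [Ax Ux]; have [n gn] := gA x Ax; exists n.
    rewrite ramp_out// subr0 mulr1 (le_trans gn)//.
    by apply: covered_le cov _; exact: leq_addr.
  - move=> n; rewrite lerBrDl.
    have b1 : bmeas (fun x => g k x * ramp U k x).
      exact/nonneg_cb_bmeas/nonneg_cbM.
    have b2 : bmeas (fun x => g (n + k)%N x * (1 - ramp U k x)).
      exact/nonneg_cb_bmeas/nonneg_cbM.
    rewrite -(mfD mfL b1 b2); apply: le_trans (gL (n + k)%N).
    apply: (mf_le mfL); [exact: bmeasD|exact: nonneg_cb_bmeas|move=> x].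
    have : g k x * ramp U k x <= g (n + k)%N x * ramp U k x.
      by rewrite ler_wpM2r ?ramp_ge0//; apply: covered_le cov _; exact: leq_addl.
    lra.
rewrite addrC -lerBrDl.
apply: (@outer_le _ (fun n x => g n x * ramp U n x)); split=> //.
- by move=> n; exact: nonneg_cbM.
- move=> n x; apply: ler_pM; rewrite ?ramp_ge0 ?ramp_le//.
  by have [] := cg n.
- move=> x [Ax Ux]; have [n gn] := gA x Ax; have [j jU] := ramp_eq1 oU Ux.
  exists (maxn n j); rewrite jU ?leq_maxr// mulr1 (le_trans gn)//.
  by apply: covered_le cov _; exact: leq_maxl.
Qed.

Let measurable_caratheodory A : measurable A ->
  (outer_ext : outer_measure R E).-caratheodory A.
Proof.
have sub : sigma_algebra setT ((outer_ext : outer_measure R E).-caratheodory).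
  split; first exact: caratheodory_measurable_set0.
    by move=> B mB; rewrite setTD; exact: caratheodory_measurable_setC.
  exact: caratheodory_measurable_bigcup.
rewrite measurable_borel => mA.
by apply: (smallest_sub sub _ mA) => U oU; exact: caratheodory_open.
Qed.

Let outer_ext_sigma_additive : semi_sigma_additive outer_ext.
Proof.
move=> F mF tF mUF.
apply: (@caratheodory_measure_sigma_additive R E outer_ext) => //.
  by move=> i; exact: measurable_caratheodory.
exact: measurable_caratheodory.
Qed.

Definition riesz_measure : set E -> \bar R := outer_ext.

HB.instance Definition _ := isMeasure.Build d E R riesz_measure
  outer_ext0 outer_ext_ge0 outer_ext_sigma_additive.

Let riesz_measureT : riesz_measure setT = 1%E.
Proof.
congr EFin; apply/eqP; rewrite eq_le outer_le1/= -[leLHS](mf1 mfL).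
apply: le_outer => [x|x|x /(_ I)//]; first exact: cvg_cst.
by rewrite ler01 lexx.
Qed.

HB.instance Definition _ := Measure_isProbability.Build d E R riesz_measure
  riesz_measureT.

Definition riesz_probability : probability E R := riesz_measure.

(* The part of y between the levels k and k + 1. *)
Let slice (y : R) (k : nat) : R := Num.min 1 (Num.max 0 (y - k%:R)).

Let sum_slice y N : 0 <= y -> \sum_(k < N) slice y k = Num.min y N%:R.
Proof.
move=> y0; elim: N => [|N IH]; first by rewrite big_ord0 min_r.
rewrite big_ord_recr/= IH /slice -natr1.
by case: (leP y N%:R) => yN; case: (leP 0 (y - N%:R)) => h0;
  case: (leP 1 _) => h1; case: (leP y (N%:R + 1)) => h2; lra.
Qed.

(** Cut N * f into N slices. The slice at level k vanishes outside {N * f > k} and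
    is 1 on {N * f > k + 1}, so that L and the measure are compared through the
    measures of these sets, with an error of one slice, that is 1 / N. *)
Let riesz_ge f : continuous f -> (forall x, 0 <= f x <= 1) ->
  L f <= mean riesz_probability f.
Proof.
move=> cf f01; set nu := riesz_probability.
have bf : bmeas f.
  exact: bmeas_between (continuous_measurable_euclidean cf) f01.
apply/ler_addgt0Pr => e e0.
have [n Ne] : exists n, 1 <= e * n.+1%:R.
  exists (Num.bound e^-1); rewrite -ler_pdivrMl// mulr1 ltW//.
  apply: (@lt_le_trans _ _ (Num.bound e^-1)%:R); last by rewrite ler_nat.
  by rewrite archi_boundP// invr_ge0 ltW.
set N := n.+1 in Ne; have N0 : 0 < N%:R :> R by [].
pose psi k x := slice (N%:R * f x) k.
have psi01 k x : 0 <= psi k x <= 1.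
  by rewrite /psi /slice le_min ler01 le_max lexx ge_min lexx.
have cpsi k : continuous (psi k).
  have : continuous (fun x => Num.min (1 : R) (Num.max 0 (N%:R * f x - k%:R))).
    move=> x; apply: (@continuous_min _ _ (fun=> 1) (fun x => Num.max 0 (N%:R * f x - k%:R))); first exact: cvg_cst.
    apply: (@continuous_max _ _ (fun=> 0) (fun x => N%:R * f x - k%:R)); first exact: cvg_cst.
    apply: cvgB; last exact: cvg_cst.
    by apply: cvgMr; exact: cf.
  exact.
have bpsi k : bmeas (psi k).
  exact: bmeas_between (continuous_measurable_euclidean (cpsi k)) (psi01 k).
have fE : (fun x => \sum_(k < N) psi k x) = (fun x => N%:R * f x).
  apply/funext => x; have /andP[f0 f1] := f01 x.
  by rewrite /psi sum_slice ?mulr_ge0// min_l// ler_piMr.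
have mfsum (l : (E -> R) -> R) : mean_functional l ->
    N%:R * l f = \sum_(k < N) l (psi k).
  move=> mfl; rewrite -(mfZ mfl)// -fE.
  exact: (mf_sum mfl _ (fun k : 'I_N => bpsi k)).
pose A k := [set x | k%:R < N%:R * f x].
have oA k : open (A k).
  rewrite (_ : A k = (fun x => N%:R * f x) @^-1` [set y | k%:R < y])//.
  apply: open_comp; last exact: open_gt.
  by move=> x _; apply: cvgMr; exact: cf.
have L_le k : L (psi k) <= outer (A k).
  apply: le_outer => // x /negP; rewrite -leNgt /psi /slice => xk.
  by rewrite max_l ?min_r//; lra.
have le_nu k : outer (A k.+1) <= mean nu (psi k).
  have mA := open_measurable_euclidean (oA k.+1).
  have -> : outer (A k.+1) = mean nu \1_(A k.+1).
    by apply: EFin_inj; rewrite (mean_indic nu mA).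
  apply: le_mean => //; first exact: bmeas_indic.
  move=> x; rewrite indicE; have [h|h] := pselect (A k.+1 x); last first.
    by rewrite memNset//; have /andP[] := psi01 k x.
  rewrite mem_set// /psi /slice.
  have {}h : k%:R + 1 < N%:R * f x by rewrite natr1.
  by rewrite min_l// le_max; apply/orP; right; lra.
have EL := mfsum _ mfL; have Enu := mfsum _ (mean_mean_functional nu).
rewrite -(ler_pM2l N0) mulrDr EL Enu.
apply: (@le_trans _ _ (\sum_(k < N) outer (A k))); first exact: ler_sum.
rewrite big_ord_recl/= addrC.
apply: lerD; last by rewrite mulrC; apply: le_trans Ne; exact: outer_le1.
rewrite [leRHS]big_ord_recr/=; apply: ler_wpDr; last exact: ler_sum.
by apply: mean_ge0 => x; have /andP[] := psi01 n x.
Qed.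

(** The inequality riesz_ge applies to 1 - f too. *)
Lemma riesz_meanE f : continuous f -> (forall x, 0 <= f x <= 1) ->
  mean riesz_probability f = L f.
Proof.
move=> cf f01; apply/eqP; rewrite eq_le (riesz_ge cf f01) andbT.
have bf : bmeas f.
  exact: bmeas_between (continuous_measurable_euclidean cf) f01.
have b1 : bmeas (fun _ : E => 1 : R) by exact: bmeas_cst.
have : L (fun x => 1 - f x) <= mean riesz_probability (fun x => 1 - f x).
  apply: riesz_ge => x; first by apply: cvgB; [exact: cvg_cst|exact: cf].
  by have /andP[f0 f1] := f01 x; apply/andP; split; lra.
by rewrite (mfB mfL b1 bf) (meanB _ b1 bf) (mf1 mfL) mean_cst; lra.
Qed.

End riesz.

(** * Partitions of unity *)

Section partition_of_unity.
Context (R : realType) (d : measure_display) (E : euclideanType R d).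
Implicit Types (x p : E) (s : seq E).

Let bump (r : R) p x : R := Num.max 0 (Num.min 1 (2 - `|x - p| / r)).

Let bump_ge0 r p x : 0 <= bump r p x.
Proof. by rewrite /bump le_max lexx. Qed.

Let continuous_bump r p : continuous (bump r p).
Proof.
have : continuous (fun x => Num.max (0 : R) (Num.min 1 (2 - `|x - p| / r))).
  move=> x; apply: (@continuous_max _ _ (fun=> 0)
    (fun x => Num.min (1 : R) (2 - `|x - p| / r))); first exact: cvg_cst.
  apply: (@continuous_min _ _ (fun=> 1) (fun x => 2 - `|x - p| / r)); first exact: cvg_cst.
  apply: cvgB; first exact: cvg_cst.
  apply: cvgMl; apply: cvg_norm; apply: cvgB; first exact: cvg_id.
  exact: cvg_cst.
exact.
Qed.

(** Bumps around the points of a finite net of the ball, divided by their sum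
    where it exceeds 1. *)
Lemma partition_of_unity (b r : R) : 0 < r ->
  exists (s : seq E) (phi : E -> E -> R),
    [/\ forall p, continuous (phi p), forall p x, 0 <= phi p x <= 1,
        forall x, \sum_(p <- s) phi p x <= 1,
        forall x, `|x| <= b -> \sum_(p <- s) phi p x = 1 &
        forall p x, 2 * r <= `|x - p| -> phi p x = 0].
Proof.
move=> r0; have := @compact_norm_le R d E b; rewrite compact_cover.
move=> /(_ E setT (fun p => ball p r)) [].
- by move=> p _; exact: ball_open.
- by move=> x _; exists x => //; exact: ballxx.
move=> D _ cov; exists (finmap.enum_fset D).
pose S x := \sum_(p <- finmap.enum_fset D) bump r p x.
have cS : continuous S by apply: (continuous_big add_continuous) => p _; exact: continuous_bump.
have M0 x : 0 < Num.max 1 (S x) by rewrite lt_max ltr01.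
have sumE x : \sum_(p <- finmap.enum_fset D) bump r p x / Num.max 1 (S x) =
    S x / Num.max 1 (S x) by rewrite -mulr_suml.
exists (fun p x => bump r p x / Num.max 1 (S x)); split.
- move=> p x; apply: cvgM; first exact: continuous_bump.
  apply: cvgV; first by rewrite gt_eqF.
  by apply: (@continuous_max _ _ (fun=> 1) S); [exact: cvg_cst|exact: cS].
- move=> p x; rewrite divr_ge0 ?(ltW (M0 x))//= ler_pdivrMr// mul1r.
  by rewrite le_max; apply/orP; left; rewrite ge_max ler01 ge_min lexx.
- by move=> x; rewrite sumE ler_pdivrMr// mul1r le_max lexx orbT.
- move=> x xb; rewrite sumE; have [p /= pD xp] := cov x xb.
  have S1 : 1 <= S x.
    rewrite /S (bigD1_seq p)//=; apply: ler_wpDr.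
      by apply: sumr_ge0 => q _.
    rewrite /bump le_max; apply/orP; right; rewrite le_min lexx/=.
    have : `|x - p| / r <= 1.
      rewrite ler_pdivrMr// mul1r distrC ltW//.
      by move: xp; rewrite -ball_normE.
    lra.
  by rewrite max_r// divff// gt_eqF// (lt_le_trans ltr01).
- move=> p x xp; rewrite /bump max_l ?mul0r// ge_min; apply/orP; right.
  have : 2 <= `|x - p| / r by rewrite ler_pdivlMr.
  lra.
Qed.

End partition_of_unity.

(** * Convergence to an invariant measure *)

Section convergence.
Context (R : realType) (d : measure_display) (E : euclideanType R d).
Variables (rho : randmap R E) (c : R) (mu0 : probability E R).
Hypotheses (c0 : 0 < c) (avg_rho : rm_averaged c rho) (tight_mu0 : tight rho mu0).
Implicit Types (x y : E) (f : E -> R).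
Notation P := (op rho).
Notation expect k f := (mean mu0 (iter k P f)).

Section ultralimit.
Variable G : set_system nat.
Hypotheses (ultraG : UltraFilter G) (ooG : \oo `<=` G).

Let properG : ProperFilter G := @ultra_proper _ _ ultraG.
Local Existing Instance properG.

Let bounded_cvg (u : nat -> R) C : (forall n, `|u n| <= C) ->
  u @ G --> lim (u @ G).
Proof.
move=> uC; have [|l [_ clu]] := @segment_compact R (- C) C (u @ G) _.
  suff : G [set n | u n \in `[- C, C]] by [].
  by apply: filterE => n /=; rewrite in_itv/= -ler_norml; exact: uC.
apply/cvg_ex; exists l => V Vl.
have [//|GV] := in_ultra_setVsetC (u @^-1` V) ultraG.
by have [y [/= nVy Vy]] := clu (~` V) V GV Vl.
Qed.

(** A limit point of the laws of the iterates, which has yet to be shown to come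
    from a measure. *)
Definition limit_mean f : R := lim (expect n f @[n --> G]).

Lemma limit_mean_cvg f : bmeas f -> expect n f @[n --> G] --> limit_mean f.
Proof.
move=> bf; have [mf [C fC]] := bf; apply: (@bounded_cvg _ C) => n.
have mfn := mean_functional_iter_op rho n (mean_mean_functional mu0).
rewrite ler_norml; apply/andP; split.
  by apply: (mf_ge_cst mfn) => // x; have := fC x; rewrite ler_norml => /andP[].
by apply: (mf_le_cst mfn) => // x; have := fC x; rewrite ler_norml => /andP[].
Qed.

Lemma mean_functional_limit_mean : mean_functional limit_mean.
Proof.
have mfn n := mean_functional_iter_op rho n (mean_mean_functional mu0).
split=> [f g bf bg|a f bf|f bf f0|].
- apply: cvg_lim => //.
  under eq_fun do rewrite (mfD (mfn _))//.
  by apply: cvgD; exact: limit_mean_cvg.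
- apply: cvg_lim => //.
  under eq_fun do rewrite (mfZ (mfn _))//.
  by apply: cvgMr; exact: limit_mean_cvg.
- apply: limr_ge; first by apply/cvg_ex; eexists; exact: limit_mean_cvg.
  by apply: nearW => n; exact: (mf_ge0 (mfn n)).
- apply: cvg_lim => //.
  under eq_fun do rewrite (mf1 (mfn _)).
  exact: cvg_cst.
Qed.

Lemma tight_limit_mean eta : 0 < eta -> exists s, limit_mean (far s) <= eta.
Proof.
move=> eta0; have [s hs] := tight_mu0 eta0; exists s.
apply: limr_le; last exact: nearW.
by apply/cvg_ex; eexists; apply: limit_mean_cvg; exact: bmeas_far.
Qed.

Let nu : probability E R :=
  riesz_probability mean_functional_limit_mean tight_limit_mean.

Let nuE f : continuous f -> (forall x, `|f x| <= 1) -> mean nu f = limit_mean f.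
Proof.
move=> cf f1; have mfL := mean_functional_limit_mean.
have bf : bmeas f.
  by split; [exact: continuous_measurable_euclidean|exists 1].
have b1 : bmeas (fun x => f x + 1) by apply: bmeasD => //; exact: bmeas_cst.
have : mean nu (fun x => 2^-1 * (f x + 1)) =
    limit_mean (fun x => 2^-1 * (f x + 1)).
  apply: riesz_meanE.
    move=> x; apply: cvgMr; apply: cvgD; [exact: cf|exact: cvg_cst].
  by move=> x; have := f1 x; rewrite ler_norml => /andP[? ?]; apply/andP; split; lra.
rewrite meanZ// (mfZ mfL)// meanD//; last exact: bmeas_cst.
rewrite (mfD mfL)//; last exact: bmeas_cst.
by rewrite mean_cst (mf_cst mfL); lra.
Qed.

(** This is asymptotic regularity, read along G. *)
Let nu_op K f : 0 <= K -> bounded_lipschitz K f -> mean nu (P f) = mean nu f.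
Proof.
move=> K0 h; have hP := bounded_lipschitz_op c0 avg_rho K0 h.
rewrite !nuE ?h.1 ?hP.1//; last 4 first.
- exact: bounded_lipschitz_continuous h.
- exact: h.1.
- exact: bounded_lipschitz_continuous hP.
- exact: hP.1.
have cf := limit_mean_cvg (bmeas_bounded_lipschitz h).
have cPf := limit_mean_cvg (bmeas_bounded_lipschitz hP).
have dG : (expect n (P f) - expect n f) @[n --> G] -->
    limit_mean (P f) - limit_mean f by exact: cvgB.
have doo : (expect n (P f) - expect n f) @[n --> \oo] --> (0 : R).
  apply/cvgr0Pnorm_le => e e0.
  have [N hN] := asymptotic_regularity c0 avg_rho tight_mu0 K0 e0.
  by exists N => // n /= Nn; rewrite -iterSr; exact: hN.
have dG0 : (expect n (P f) - expect n f) @[n --> G] --> (0 : R).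
  by apply: cvg_trans doo; move=> A /ooG.
by apply/eqP; rewrite -subr_eq0; apply/eqP; exact: cvg_unique dG dG0.
Qed.

Let nu_op_iter K f n : 0 <= K -> bounded_lipschitz K f ->
  mean nu (iter n P f) = mean nu f.
Proof.
move=> K0 h; elim: n => //= n <-; apply: (nu_op K0).
exact: (bounded_lipschitz_iter_op c0 avg_rho n K0 h).
Qed.

(** Up to a small error, a test function is determined by its values at finitely
    many points, those of a partition of unity on a ball carrying most of the
    mass. So convergence along G is uniform over the class of test functions. *)
Let near_once K eps : 0 <= K -> 0 < eps ->
  exists n, forall f, bounded_lipschitz K f -> `|expect n f - mean nu f| <= eps.
Proof.
move=> K0 eps0.
have mfL := mean_functional_limit_mean.
have eps4 : 0 < eps / 8 by rewrite divr_gt0.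
have [b hb] := tight_mu0 eps4.
pose r := eps / (16 * (K + 1)).
have r0 : 0 < r by rewrite divr_gt0// mulr_gt0//; lra.
have rK : K * (2 * r) <= eps / 8.
  have -> : K * (2 * r) = eps / 8 * (K / (K + 1)) by rewrite /r; field; lra.
  rewrite ler_piMr ?(ltW eps4)// ler_pdivrMr ?mul1r ?lerDl//; lra.
have [s [phi [cphi phi01 sum1 sumb supp]]] := partition_of_unity E b r0.
have phi0 p x : 0 <= phi p x by have /andP[] := phi01 p x.
have bphi p : bmeas (phi p).
  exact: bmeas_between (continuous_measurable_euclidean (cphi p)) (phi01 p).
pose S x := \sum_(p <- s) phi p x; pose w x := 1 - S x.
have w01 x : 0 <= w x <= 1.
  by rewrite /w subr_ge0 sum1/= gerBl; apply: sumr_ge0.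
have cw : continuous w.
  by move=> x; apply: cvgB; [exact: cvg_cst|exact: (continuous_big add_continuous (fun p _ => cphi p))].
have bw : bmeas w.
  exact: bmeas_between (continuous_measurable_euclidean cw) w01.
have w_small k : expect k w <= eps / 8.
  apply: le_trans (hb k); apply: le_mean; [exact: bmeas_iter_op| |].
    by apply: bmeas_iter_op; exact: bmeas_far.
  apply: le_iter_op => //; first exact: bmeas_far.
  move=> x; rewrite /far; have [xb|xb] := leP `|x| b.
    by rewrite /w /S sumb// subrr.
  by have /andP[] := w01 x.
have nu_w : mean nu w <= eps / 8.
  rewrite nuE//; last by move=> x; have /andP[? ?] := w01 x; rewrite ger0_norm.
  apply: limr_le; last exact: nearW.
  by apply/cvg_ex; eexists; exact: limit_mean_cvg.
have approx (l : (E -> R) -> R) f : mean_functional l -> l w <= eps / 8 ->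
    bounded_lipschitz K f ->
    `|l f - \sum_(p <- s) f p * l (phi p)| <= eps / 4.
  move=> mfl lw h; have bf := bmeas_bounded_lipschitz h; have [f1 fK] := h.
  have bsum : bmeas (fun x => \sum_(p <- s) f p * phi p x).
    by apply: bmeas_sum => p; exact: bmeasZ.
  have -> : \sum_(p <- s) f p * l (phi p) = l (fun x => \sum_(p <- s) f p * phi p x).
    rewrite (mf_sum mfl) => [|p]; last exact: bmeasZ.
    by apply: eq_bigr => p _; rewrite (mfZ mfl).
  have bd : bmeas (fun x => eps / 8 + w x) by apply: bmeasD => //; exact: bmeas_cst.
  have ld : l (fun x => eps / 8 + w x) <= eps / 4.
    rewrite (mfD mfl) ?(mf_cst mfl)//; last exact: bmeas_cst.
    lra.
  have point x : `|f x - \sum_(p <- s) f p * phi p x| <= eps / 8 + w x.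
    have -> : f x - \sum_(p <- s) f p * phi p x =
        \sum_(p <- s) (f x - f p) * phi p x + f x * w x.
      have -> : \sum_(p <- s) (f x - f p) * phi p x =
          f x * S x - \sum_(p <- s) f p * phi p x.
        rewrite /S mulr_sumr -sumrB; apply: eq_bigr => p _; ring.
      rewrite /w; ring.
    apply: (le_trans (ler_normD _ _)); apply: lerD; last first.
      have /andP[wx0 _] := w01 x.
      by rewrite normrM (ger0_norm wx0) ler_piMl.
    apply: (le_trans (ler_norm_sum _ _ _)).
    apply: (@le_trans _ _ (\sum_(p <- s) eps / 8 * phi p x)); last first.
      by rewrite -mulr_sumr ler_piMr// ltW.
    apply: ler_sum => p _; rewrite normrM (ger0_norm (phi0 _ _)).
    have [xp|xp] := leP (2 * r) `|x - p|; first by rewrite supp// !mulr0.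
    apply: ler_wpM2r => //; apply: (le_trans (fK _ _)); apply: le_trans rK.
    by rewrite ler_wpM2l// ltW.
  rewrite -(mfB mfl)// ler_norml; apply/andP; split.
    have := mf_le mfl (bmeasN bd) (bmeasB bf bsum).
    rewrite (mfN mfl bd) => hle; apply: le_trans (hle _); first by rewrite lerN2.
    by move=> x; have := point x; rewrite ler_norml => /andP[].
  apply: le_trans ld; apply: (mf_le mfl) => //; first exact: bmeasB.
  by move=> x; have := point x; rewrite ler_norml => /andP[].
pose e' := eps / (4 * (size s).+1%:R).
have e'0 : 0 < e' by rewrite divr_gt0// mulr_gt0.
have close (t : seq E) : G [set n | forall p, p \in t ->
    `|expect n (phi p) - mean nu (phi p)| <= e'].
  elim: t => [|p t IH]; first exact: filterE.
  have cp := limit_mean_cvg (bphi p); rewrite -nuE// in cp; last first.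
    by move=> x; have /andP[? ?] := phi01 p x; rewrite ger0_norm.
  have near_p : G [set n | `|expect n (phi p) - mean nu (phi p)| <= e'].
    by move/cvgrPdistC_le : cp => /(_ _ e'0).
  apply: filterS2 near_p IH => n h1 h2 q.
  by rewrite inE => /orP[/eqP->//|]; exact: h2.
have [n hn] := filter_ex (close s); exists n => f h.
have mfn := mean_functional_iter_op rho n (mean_mean_functional mu0).
have a1 := approx _ _ mfn (w_small n) h.
have a2 := approx _ _ (mean_mean_functional nu) nu_w h.
have a3 : `|\sum_(p <- s) f p * expect n (phi p) -
    \sum_(p <- s) f p * mean nu (phi p)| <= eps / 4.
  rewrite -sumrB; apply: (le_trans (ler_norm_sum _ _ _)).
  apply: (@le_trans _ _ (\sum_(p <- s) e')).
    rewrite big_seq [leRHS]big_seq; apply: ler_sum => p ps.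
    rewrite -mulrBr normrM -[leRHS]mul1r; apply: ler_pM => //; first exact: h.1.
    exact: hn.
  rewrite big_const_seq count_predT iter_addr_0 -[e' *+ _]mulr_natr /e'.
  rewrite (_ : eps / (4 * (size s).+1%:R) * (size s)%:R =
    eps / 4 * ((size s)%:R / (size s).+1%:R)); last first.
    by field; rewrite gt_eqF.
  rewrite ler_piMr//; first by rewrite divr_ge0// ltW.
  by rewrite ler_pdivrMr// mul1r ler_nat.
move: a1 a2 a3; rewrite !ler_norml => /andP[? ?] /andP[? ?] /andP[? ?].
by apply/andP; split; lra.
Qed.

(** Once the law of an iterate is close to nu, later ones are as close, because P
    preserves both nu and the test functions. *)
Lemma ultralimit_convergence : exists nu : probability E R,
  (forall K f, 0 <= K -> bounded_lipschitz K f -> mean nu (P f) = mean nu f) /\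
  (forall K eps, 0 <= K -> 0 < eps -> exists N, forall n, (N <= n)%N ->
     forall f, bounded_lipschitz K f -> `|expect n f - mean nu f| <= eps).
Proof.
exists nu; split; first exact: nu_op.
move=> K eps K0 eps0; have [N hN] := near_once K0 eps0; exists N => n Nn f h.
rewrite -(subnKC Nn) iterD -(nu_op_iter (n - N) K0 h).
apply: hN; exact: (bounded_lipschitz_iter_op c0 avg_rho _ K0 h).
Qed.

End ultralimit.

Lemma invariant_limit : exists nu : probability E R,
  (forall K f, 0 <= K -> bounded_lipschitz K f -> mean nu (P f) = mean nu f) /\
  (forall K eps, 0 <= K -> 0 < eps -> exists N, forall n, (N <= n)%N ->
     forall f, bounded_lipschitz K f -> `|expect n f - mean nu f| <= eps).
Proof.
have [G [uG ooG]] := ultraFilterLemma (eventually_filter).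
exact: ultralimit_convergence uG ooG.
Qed.

End convergence.

(** * Transition kernels and the Prokhorov distance *)

Section kernel_operator.
Context (R : realType) (d dI dO : measure_display) (E : euclideanType R d)
  (I : measurableType dI) (Omega : measurableType dO) (P : probability Omega R).
Variable T : I -> E -> E.
Hypothesis mT : measurable_fun [set: E * I] (fun z : E * I => T z.2 z.1).
Variable xi : {RV P >-> I}.

Definition noise_law : probability I R := distribution P xi.

Definition iteration_map : randmap R E := @RandMap R d E dI I noise_law T mT.

Notation p := (transition_kernel mT xi).

Lemma transition_op (x : E) (A : set E) : measurable A ->
  p x A = (op iteration_map \1_A x)%:E.
Proof.
move=> mA; have mA' : measurable [set i | A (T i x)].
  have mx : measurable_fun [set: I] (fun i => T i x).
    exact: (measurable_fun_pair2 x mT).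
  by rewrite -[X in measurable X]setTI; exact: mx.
rewrite /op (_ : (fun j => _) = \1_[set i | A (T i x)]).
  by rewrite mean_indic.
by apply/funext => i; rewrite !indicE; congr (nat_of_bool _)%:R.
Qed.

Lemma markov_op_op (mu : probability E R) (A : set E) : measurable A ->
  markov_op p mu A = (mean mu (op iteration_map \1_A))%:E.
Proof.
move=> mA; rewrite EFin_mean; last exact/bmeas_op/bmeas_indic.
by apply: eq_integral => x _; exact: transition_op.
Qed.

Lemma mean_markov_op (mu : probability E R) f : bmeas f ->
  mean (markov_op p mu) f = mean mu (op iteration_map f).
Proof.
move=> bf.
pose h : {mfun (E * I)%type >-> E} := HB.pack_for {mfun (E * I)%type >-> E}
  (fun z : E * I => T z.2 z.1)
  (isMeasurableFun.Build _ _ _ _ (fun z : E * I => T z.2 z.1) mT).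
pose nu : probability E R := distribution (mu \x noise_law)%E h.
have eq_nu g : bmeas g -> mean nu g = mean mu (op iteration_map g).
  move=> bg; have bgh : bmeas (fun z : E * I => g (T z.2 z.1)).
    exact: (bmeas_comp mT).
  rewrite -[RHS](mean_prod mu noise_law (F := fun z => g (T z.2 z.1)))//.
  rewrite /mean /Rintegral; congr fine.
  apply: integral_pushforward => //.
  + by apply/measurable_EFinP; exact: bmeas_measurable.
  + by rewrite preimage_setT; exact: (bmeas_integrable (mu \x noise_law)%E bgh).
rewrite -eq_nu//; apply: eq_mean => A mA.
apply: (etrans (markov_op_op mu mA)).
by rewrite -eq_nu ?mean_indic//; exact: bmeas_indic.
Qed.

Lemma mean_markov_iter (mu : probability E R) k f : bmeas f ->
  mean (markov_iter p mu k) f = mean mu (iter k (op iteration_map) f).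
Proof.
elim: k f => [//|k IH] f bf.
by rewrite iterSr -IH; [exact: mean_markov_op|exact: bmeas_op].
Qed.

Lemma inv_measures_op (pi : probability E R) : inv_measures p pi ->
  forall f, bmeas f -> mean pi (op iteration_map f) = mean pi f.
Proof.
by move=> inv f bf; rewrite -mean_markov_op//; apply: eq_mean => A; exact: inv.
Qed.

(** The ramps are test functions, and their expectations determine a measure. *)
Lemma op_inv_measures (pi : probability E R) :
  (forall K f, 0 <= K -> bounded_lipschitz K f ->
     mean pi (op iteration_map f) = mean pi f) -> inv_measures p pi.
Proof.
move=> inv A mA; apply: (@probability_eq_ramp _ _ _ (markov_op p pi) pi) => //.
move=> U k oU; have h := bounded_lipschitz_ramp U k.
by rewrite mean_markov_op ?(inv k%:R)//; exact: bmeas_bounded_lipschitz h.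
Qed.

End kernel_operator.

Section prokhorov_bounds.
Context (R : realType) (d : measure_display) (E : euclideanType R d).
Implicit Types (mu nu : probability E R) (A : set E).

Lemma measurable_enlargement A (e : R) : measurable (enlargement A e).
Proof.
apply: open_measurable_euclidean; apply: bigcup_open => x _; exact: ball_open.
Qed.

(** Equal to 1 on A and, if e <= 1, to 0 outside the e-enlargement of A. *)
Definition cutoff A (e : R) (x : E) : R := 1 - Num.min 1 (tdist A x / e).

Let cutoff01 A e x : 0 < e -> 0 <= cutoff A e x <= 1.
Proof.
move=> e0; rewrite /cutoff subr_ge0 ge_min lexx/= gerBl le_min ler01.
by rewrite divr_ge0 ?tdist_ge0// ltW.
Qed.

Lemma bounded_lipschitz_cutoff A e : 0 < e -> bounded_lipschitz e^-1 (cutoff A e).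
Proof.
move=> e0; split=> [x|x y].
  by have /andP[h0 h1] := cutoff01 A x e0; rewrite ger0_norm.
have half u v : Num.min 1 (tdist A u / e) <= Num.min 1 (tdist A v / e) + e^-1 * `|u - v|.
  have kt : tdist A u / e <= tdist A v / e + e^-1 * `|u - v|.
    rewrite [e^-1 * _]mulrC -mulrDl ler_pM2r ?invr_gt0//.
    by have := tdist_lipschitz A u v; rewrite ler_norml => /andP[_]; lra.
  have n0 : 0 <= e^-1 * `|u - v| by rewrite mulr_ge0// invr_ge0 ltW.
  by rewrite -lerBlDr le_min !lerBlDr !ge_min lerDl n0 kt orbT.
have := half x y; have := half y x; rewrite (distrC y x) /cutoff => h1 h2.
by rewrite ler_norml; apply/andP; split; lra.
Qed.

Let prokhorov_set mu nu : set R := [set e : R | 0 < e /\ forall A : set E,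
  measurable A -> (mu A <= nu (enlargement A e) + e%:E)%E /\
                  (nu A <= mu (enlargement A e) + e%:E)%E].

Lemma prokhorov_dist_ge0 mu nu : 0 <= prokhorov_dist mu nu.
Proof.
have [[e Se]|S0] := pselect (prokhorov_set mu nu !=set0).
  by apply: lb_le_inf; [exists e|move=> x [/ltW]].
rewrite /prokhorov_dist (_ : [set e : R | _] = set0) ?inf0//.
by apply/seteqP; split => // e Se; apply: S0; exists e.
Qed.

Let le_enlargement mu nu A e : 0 < e <= 1 -> measurable A ->
  `|mean mu (cutoff A e) - mean nu (cutoff A e)| <= e ->
  (mu A <= nu (enlargement A e) + e%:E)%E.
Proof.
move=> /andP[e0 e1] mA h.
have bc := bmeas_bounded_lipschitz (bounded_lipschitz_cutoff A e0).
have mB := measurable_enlargement A e.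
have bB := bmeas_indic R mB; have bA := bmeas_indic R mA.
have h1 : mean mu \1_A <= mean mu (cutoff A e).
  apply: le_mean => // x; rewrite indicE.
  have [Ax|Ax] := pselect (A x); last first.
    by rewrite memNset//; have /andP[] := cutoff01 A x e0.
  by rewrite mem_set// /cutoff tdist_in// mul0r min_r ?ler01// subr0.
have h2 : mean nu (cutoff A e) <= mean nu \1_(enlargement A e).
  apply: le_mean => // x; rewrite indicE.
  have [Bx|Bx] := pselect (enlargement A e x).
    by rewrite mem_set//; have /andP[] := cutoff01 A x e0.
  rewrite memNset// /cutoff min_l ?subrr//= ler_pdivlMr// mul1r leNgt.
  apply/negP => /(tdist_lt e1)[a Aa xa]; apply: Bx; exists a => //.
  by rewrite -ball_normE /= distrC.
rewrite -(mean_indic mu mA) -(mean_indic nu mB) -EFinD lee_fin.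
by move: h; rewrite ler_norml => /andP[_]; lra.
Qed.

Lemma prokhorov_dist_le mu nu e : 0 < e <= 1 ->
  (forall f, bounded_lipschitz e^-1 f -> `|mean mu f - mean nu f| <= e) ->
  prokhorov_dist mu nu <= e.
Proof.
move=> e01 h; have /andP[e0 e1] := e01; apply: ge_inf.
  by exists 0 => x [/ltW].
split=> // A mA; have hA := h _ (bounded_lipschitz_cutoff A e0).
by split; apply: le_enlargement => //; rewrite distrC.
Qed.

Lemma eq_prokhorov_dist mu mu' nu :
  (forall A, measurable A -> mu A = mu' A) ->
  prokhorov_dist mu nu = prokhorov_dist mu' nu.
Proof.
move=> mumu'; rewrite /prokhorov_dist; congr inf.
apply/seteqP; split=> e /= [e0 h]; split=> // A mA; have [h1 h2] := h A mA;
  have mB := measurable_enlargement A e; split.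
- by rewrite -mumu'.
- by rewrite -mumu'.
- by rewrite mumu'.
- by rewrite mumu'.
Qed.

End prokhorov_bounds.

(** * The law of the iterates *)

(** Rectangles form a pi-system generating the product sigma-algebra. *)
Lemma eq_measure_rectangles (R : realType) (d1 d2 : measure_display)
  (T1 : measurableType d1) (T2 : measurableType d2)
  (m1 m2 : {measure set (T1 * T2)%type -> \bar R}) :
  (m1 setT < +oo)%E ->
  (forall A B, measurable A -> measurable B -> m1 (A `*` B) = m2 (A `*` B)) ->
  forall S, measurable S -> m1 S = m2 S.
Proof.
move=> fin rect S mS.
pose C : set (set (T1 * T2)) :=
  [set C | exists2 A, measurable A & exists2 B, measurable B & C = A `*` B].
apply: (measure_unique C (fun=> setT)) => //.
- rewrite measurable_prod_measurableType//; congr (<<s _ >>).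
  apply/seteqP; split=> [_ [A mA [B mB <-]]|_ [A mA [B mB ->]]].
    by exists A => //; exists B.
  by exists A => //; exists B.
- move=> _ _ [A mA [B mB ->]] [A' mA' [B' mB' ->]]; rewrite -setXI.
  by exists (A `&` A'); [exact: measurableI|exists (B `&` B') => //; exact: measurableI].
- by move=> _; exists setT => //; exists setT => //; rewrite setXTT.
- by rewrite bigcup_const//; exists 0%N.
- by move=> _ [A mA [B mB ->]]; exact: rect.
Qed.

Section law_of_iterates.
Context (R : realType) (d dI dO : measure_display) (E : euclideanType R d)
  (I : measurableType dI) (Omega : measurableType dO) (P : probability Omega R).
Variable T : I -> E -> E.
Hypothesis mT : measurable_fun [set: E * I] (fun z : E * I => T z.2 z.1).
Variables (xi : {RV P >-> I}) (xi_ : nat -> {RV P >-> I}).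
Hypothesis xi_iid : iid_copies xi xi_.
Variables (mu0 : probability E R) (X : nat -> {RV P >-> E}).
Hypothesis rfi : random_function_iteration T xi_ mu0 X.

Notation mu k := (markov_iter (transition_kernel mT xi) mu0 k).
Notation lambda := (noise_law xi).

Let future k m (B : nat -> set I) : set Omega :=
  \bigcap_(i < m) (xi_ (k + i)%N @^-1` B i).

Let measurable_noise i (V : set I) : measurable V -> measurable (xi_ i @^-1` V).
Proof. by move=> mV; rewrite -[X in measurable X]setTI; exact: measurable_funPT. Qed.

Let mfuture k m B : (forall i, measurable (B i)) -> measurable (future k m B).
Proof.
move=> mB; apply: fin_bigcap_measurable => // i _.
exact: measurable_noise.
Qed.

(** The current state is independent of the noise still to come; the factor
    collecting the future is what allows the induction on k. *)
Lemma iterate_independent k : forall m (A : set E) (B : nat -> set I),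
  measurable A -> (forall i, measurable (B i)) ->
  (P (X k @^-1` A `&` future k m B) =
   mu k A * \prod_(i < m) P (xi_ (k + i)%N @^-1` B i))%E.
Proof.
have [X0 ind step] := rfi; have [_ copies] := xi_iid.
elim: k => [|k IH] m A B mA mB.
  case: m => [|m].
    by rewrite big_ord0 mule1 /future bigcap_mkord big_ord0 setIT; exact: X0.
  rewrite /future; under eq_bigr do rewrite add0n.
  have := ind m A B mA mB; rewrite /= => ->.
  by congr (_ * _)%E; exact: X0.
set q' := (\prod_(i < m) _)%E.
have q'fin : q' \is a fin_num.
  by apply: prode_fin_num => i _; apply: fin_num_measure; exact: measurable_noise.
have q0 : 0 <= fine q' by apply: fine_ge0; apply: prode_ge0 => i _; exact: measure_ge0.
pose D := future k.+1 m B; have mD : measurable D by exact: mfuture.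
pose pair w := (X k w, xi_ k w).
have mpair : measurable_fun [set: Omega] pair by exact: measurable_fun_pair.
(* The law of (X k, xi_ k) on the event D, and q' times the product law. They
   agree on rectangles by induction, with xi_ k joined to the future noise. *)
pose m1 : {measure set (E * I)%type -> \bar R} :=
  measure_function_pushforward__canonical__measure_function_Measure
    (mrestr P mD) mpair.
pose m2 : {measure set (E * I)%type -> \bar R} :=
  mscale (NngNum q0) (mu k \x lambda)%E.
have m1E S : m1 S = P ((pair @^-1` S) `&` D) by [].
have m2E S : m2 S = (q' * (mu k \x lambda) S)%E by rewrite -[in RHS](fineK q'fin).
have rect (U : set E) (V : set I) : measurable U -> measurable V ->
    m1 (U `*` V) = m2 (U `*` V).
  move=> mU mV; pose B' i := if i is i'.+1 then B i' else V.
  have mB' i : measurable (B' i) by case: i.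
  rewrite m1E m2E product_measure1E// muleC -muleA.
  have -> : pair @^-1` (U `*` V) `&` D = X k @^-1` U `&` future k m.+1 B'.
    apply/seteqP; split=> w.
      case=> -[Uw Vw] Dw; split=> // -[_|i im] /=; first by rewrite addn0.
      by have := Dw i im; rewrite /= addnS.
    case=> Uw Dw; split; first split=> //.
      by have := Dw 0%N erefl; rewrite /= addn0.
    by move=> i im; have := Dw i.+1 im; rewrite /= addnS.
  rewrite IH// big_ord_recl /= addn0; congr (_ * (_ * _))%E.
    exact: copies.
  by apply: eq_bigr => i _; rewrite /bump /= addnS.
pose h (z : E * I) := T z.2 z.1.
have mhA : measurable (h @^-1` A) by rewrite -[X in measurable X]setTI; exact: mT.
have -> : X k.+1 @^-1` A = pair @^-1` (h @^-1` A).
  by apply/seteqP; split => w; rewrite /preimage/= step.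
rewrite -m1E (eq_measure_rectangles _ rect)//; last first.
  by rewrite m1E preimage_setT setTI; exact: le_lt_trans (probability_le1 P mD) (ltry 1).
rewrite m2E muleC; congr (_ * _)%E.
apply: eq_integral => x _.
by rewrite /= xsectionE.
Qed.

Lemma law_of_iterates k A : measurable A ->
  distribution P (X k) A = mu k A.
Proof.
move=> mA; have := @iterate_independent k 0 A (fun=> setT) mA (fun=> measurableT).
by rewrite big_ord0 mule1 /future bigcap_mkord big_ord0 setIT.
Qed.

End law_of_iterates.

(** * Convergence of random function iterations *)

Theorem theorem2p9 (R : realType) (d dI dO : measure_display)
    (E : euclideanType R d) (I : measurableType dI)
    (Omega : measurableType dO) (P : probability Omega R)
    (xi : {RV P >-> I}) (xi_ : nat -> {RV P >-> I})
    (xi_iid : iid_copies xi xi_)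
    (T : I -> E -> E)
    (mT : measurable_fun [set: E * I] (fun z : E * I => T z.2 z.1))
    (alpha : R) (alpha_ : I -> R)
    (T_averaged : forall i, averaged (alpha_ i) (T i))
    (alpha_le : forall i, alpha_ i <= alpha)
    (alpha_lt1 : alpha < 1)
    (inv_neq0 : inv_measures (transition_kernel mT xi) !=set0)
    (mu0 : probability E R) :
  exists pi : probability E R,
    [/\ inv_measures (transition_kernel mT xi) pi,
        (fun k => prokhorov_dist (markov_iter (transition_kernel mT xi) mu0 k)
                                 pi) @ \oo --> (0 : R) &
        forall X : nat -> {RV P >-> E},
          random_function_iteration T xi_ mu0 X ->
          (forall k A, measurable A ->
             distribution P (X k) A =
             markov_iter (transition_kernel mT xi) mu0 k A) /\
          (fun k => prokhorov_dist (distribution P (X k)) pi) @ \oo -->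
            (0 : R)].
Proof.
pose rho := iteration_map mT xi.
(* A point of Omega yields an index, hence alpha > 0. *)
have [w _] : [set: Omega] !=set0.
  apply/set0P/negP => /eqP Omega0; have := @probability_setT _ _ _ P.
  by rewrite Omega0 measure0 => /eqP; rewrite eq_sym onee_eq0.
have alpha_gt0 : 0 < alpha.
  by have [/andP[a0 _] _] := T_averaged (xi w); exact: lt_le_trans a0 (alpha_le _).
pose c := (1 - alpha) / alpha.
have c_gt0 : 0 < c by rewrite divr_gt0// subr_gt0.
have avg : rm_averaged c rho.
  move=> i x y; have [/andP[a0 a1] h] := T_averaged i.
  have shift : (T i x - x) - (T i y - y) = (T i x - T i y) - (x - y).
    by rewrite !opprB addrACA [RHS]addrACA [- x - _]addrC.
  have c_le : c <= (1 - alpha_ i) / alpha_ i.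
    rewrite /c ler_pdivlMr// mulrAC ler_pdivrMr//.
    by have := alpha_le i; nra.
  have := h x y; rewrite shift; have := ler_wpM2r (sqr_ge0 `|(T i x - T i y) - (x - y)|) c_le.
  by rewrite /rm_map/=; lra.
have [pi0 inv0] := inv_neq0.
have [nu [nu_inv nu_lim]] := invariant_limit c_gt0 avg
  (tight_of_invariant mu0 c_gt0 avg (inv_measures_op inv0)).
have cvg : (fun k => prokhorov_dist (markov_iter (transition_kernel mT xi) mu0 k)
    nu) @ \oo --> (0 : R).
  apply/cvgr0Pnorm_le => e e0; pose e' := Num.min e 1.
  have e'0 : 0 < e' by rewrite lt_min e0 ltr01.
  have [N hN] := nu_lim e'^-1 e' (ltW (etrans (invr_gt0 _) e'0)) e'0.
  exists N => // n /= Nn; rewrite ger0_norm ?prokhorov_dist_ge0//.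
  apply: (@le_trans _ _ e'); last by rewrite ge_min lexx.
  apply: prokhorov_dist_le; first by rewrite e'0 ge_min lexx orbT.
  move=> f bf; rewrite mean_markov_iter; last exact: bmeas_bounded_lipschitz bf.
  exact: hN.
exists nu; split=> //; first exact: op_inv_measures.
move=> X rfi; have law := law_of_iterates mT xi_iid rfi.
split=> //; rewrite (_ : (fun k => _) = (fun k => prokhorov_dist
  (markov_iter (transition_kernel mT xi) mu0 k) nu))//.
by apply/funext => k; apply: eq_prokhorov_dist => A; exact: law.
Qed.
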